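(* Let $\Gamma$ be a finite simple graph, and let $P$ be a locally finite poset equipped with a surjective coloring function $\kappa:P\to\Gamma$. Let $\mathcal{FI}(P)$ be the lattice of filter-ideal splits of $P$. Then the following are equivalent: (i) The lattice $\mathcal{FI}(P)$ carries upper and lower $P$-minuscule representations of $\mathfrak{b}'_+$ and $\mathfrak{b}'_-$, respectively, using the same diagonal operators $\{H_a\}_{a\in\Gamma}$. (ii) The lattice $\mathcal{FI}(P)$ carries representations of $\mathfrak{b}'_+$ and $\mathfrak{b}'_-$ with diagonal operators $\{H_a\}_{a\in\Gamma}$ (the same operators for both) that satisfy for every $b\in\Gamma$ and every split $(F,I)$: $H_b.\langle F,I\rangle=-\langle F,I\rangle$ if $b$ is the color of a minimal element of $F$; $H_b.\langle F,I\rangle=+\langle F,I\rangle$ if $b$ is the color of a maximal element of $I$; and $H_b.\langle F,I\rangle=0$ otherwise. (iii) The poset $P$ satisfies the properties EC, NA, AC, I2A, Mx1GA, and Mn1LA. (iv) The lattice $\mathcal{FI}(P)$ carries $X$- and $Y$-square nilpotent representations of $\mathfrak{b}'_+$ and $\mathfrak{b}'_-$ respectively, using diagonal operators $\{H_a\}_{a\in\Gamma}$ (the same operators for both) that satisfy $[X_a,Y_a]=H_a$ for every color $a\in\Gamma$. (v) The lattice $\mathcal{FI}(P)$ carries a $P$-minuscule representation of $\mathfrak{g}'$. When any of these conditions are satisfied, the $\mu$-diagonal operators $\{M_a\}_{a\in\Gamma}$ are the unique diagonal operators satisfying (i), (ii), (iv), or (v).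
   Context: Graph and poset. $\Gamma$ has no loops or multiple edges; its vertex set is also denoted $\Gamma$ and its vertices are called colors. For $a,b\in\Gamma$, $a\sim b$ means $\{a,b\}$ is an edge (adjacent); $a,b$ are distant if $a\ne b$ and $\{a,b\}$ is not an edge. Put $\theta_{ab}=2$ if $a=b$, $\theta_{ab}=-1$ if $a\sim b$, $\theta_{ab}=0$ if $a,b$ are distant. Locally finite means every closed interval of $P$ is finite. $P_a:=\kappa^{-1}(a)$. $x\to y$ means $x$ is covered by $y$; $x,y$ are neighbors if $x\to y$ or $y\to x$. A filter is an upwardly closed subset, an ideal a downwardly closed subset. A split is a pair $(F,I)$ with $F$ a filter and $I=P-F$; $\mathcal{FI}(P)$ is the set of all splits, ordered by inclusion of ideals. Write $(F-x,I+x)$ for $(F\setminus\{x\},I\cup\{x\})$ and $(F+y,I-y)$ for $(F\cup\{y\},I\setminus\{y\})$. Operators. $V=\langle\mathcal{FI}(P)\rangle$ is the free complex vector space with basis $\{\langle F,I\rangle\}_{(F,I)\in\mathcal{FI}(P)}$. For $a\in\Gamma$ define linearly $X_a.\langle F,I\rangle=\sum\langle F-x,I+x\rangle$, summed over the elements $x$ of color $a$ minimal in $F$, and $Y_a.\langle F,I\rangle=\sum\langle F+y,I-y\rangle$, summed over the elements $y$ of color $a$ maximal in $I$. Any assertion about these operators is understood to include that the defining sums are finite, so that the operators are well defined. (Finiteness is automatic when EC holds.) $X$-square (respectively $Y$-square) nilpotent means $X_a^2=0$ (respectively $Y_a^2=0$) for all $a$. Diagonal operators are operators on $V$ diagonal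 in the basis $\{\langle F,I\rangle\}$. Lie algebras. Consider generators $x_a,y_a,h_a$ ($a\in\Gamma$) and relations: XX: $[x_b,x_a]=0$ for $a,b$ distant, and $[x_a,[x_a,x_b]]=0$ for all $a,b$; YY: the same with $y$ in place of $x$; HH: $[h_b,h_a]=0$; HX: $[h_b,x_a]=\theta_{ab}x_a$; HY: $[h_b,y_a]=-\theta_{ab}y_a$; XY: $[x_a,y_a]=h_a$, and $[x_b,y_a]=0$ for $a\ne b$. $\mathfrak{b}'_+$ is the complex Lie algebra generated by $\{x_a,h_a\}$ subject to XX, HH, HX; $\mathfrak{b}'_-$ is generated by $\{y_a,h_a\}$ subject to YY, HH, HY; $\mathfrak{g}'$ (the derived Kac--Moody algebra of $\Gamma$) is generated by $\{x_a,y_a,h_a\}$ subject to all the relations. Representations. $\mathcal{FI}(P)$ carries a representation of one of these algebras if there are operators on $V$ for its generators, with $X_a$ for $x_a$, $Y_a$ for $y_a$, and diagonal operators $H_a$ for $h_a$, satisfying the defining relations with respect to the commutator on $\mathrm{End}(V)$. The eigenvalue set of $\{H_a\}$ is the set of all eigenvalues of $H_a$ on basis vectors, over all $a$ and all splits. A representation of $\mathfrak{b}'_+$ (respectively $\mathfrak{b}'_-$) carried by $\mathcal{FI}(P)$ is upper (respectively lower) $P$-minuscule if it is $X$-square (respectively $Y$-square) nilpotent, the eigenvalue set of $\{H_a\}$ is contained in $\{-1,0,1,2,\dots\}$ (respectively $\{\dots,-2,-1,0,1\}$), and for every split $(F,I)$ and $a\in\Gamma$: $H_a.\langle F,I\rangle=-\langle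 F,I\rangle$ (respectively $+\langle F,I\rangle$) if and only if $F$ has a minimal element (respectively $I$ has a maximal element) of color $a$. A representation of $\mathfrak{g}'$ carried by $\mathcal{FI}(P)$ is $P$-minuscule if the eigenvalue set of $\{H_a\}$ is contained in $\{-1,0,1\}$. Coloring properties. EC: elements with equal colors are comparable. NA: neighbors have adjacent colors. AC: elements with adjacent colors are comparable. I2A: for every $a\in\Gamma$, the open interval between any two consecutive elements of color $a$ (i.e. $x<y$ in $P_a$ with no element of $P_a$ strictly between) contains exactly two elements whose colors are adjacent to $a$. Mx1GA: for every $a$, if $x$ is maximal in $P_a$, then at most one element greater than $x$ has color adjacent to $a$. Mn1LA: for every $a$, if $x$ is minimal in $P_a$, then at most one element less than $x$ has color adjacent to $a$. The $\mu$-diagonal operators (defined when $P$ satisfies EC). Fix $b\in\Gamma$ and a split $(F,I)$. Define $\upsilon_b(F,I)$: if $P_b\cap I$ has no maximal element, $\upsilon_b(F,I):=1$. Otherwise let $y$ be its (unique) maximal element and let $\Upsilon_b(F,I)$ be the set of $z\in I$ with $z>y$, $c:=\kappa(z)\sim b$, and only finitely many elements of $P_c\cap I$ greater than $y$; put $\upsilon_b(F,I):=|\Upsilon_b(F,I)|+1$ if some color $a\sim b$ has infinitely many elements of $P_a\cap I$ greater than $y$, and $\upsilon_b(F,I):=|\Upsilon_b(F,I)|$ otherwise. Dually define $\psi_b(F,I)$: if $P_b\cap F$ has no minimal element, $\psi_b(F,I):=1$. Otherwise let $y$ be its (unique) minimal element and let $\Psi_b(F,I)$ be the set of $z\in F$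 with $z<y$, $c:=\kappa(z)\sim b$, and only finitely many elements of $P_c\cap F$ less than $y$; put $\psi_b(F,I):=|\Psi_b(F,I)|+1$ if some $a\sim b$ has infinitely many elements of $P_a\cap F$ less than $y$, and $\psi_b(F,I):=|\Psi_b(F,I)|$ otherwise. Set $\mu_b(F,I):=1-\upsilon_b(F,I)$ if $P_b\cap I\neq\emptyset$ and $\mu_b(F,I):=-1+\psi_b(F,I)$ if $P_b\cap I=\emptyset$. The $\mu$-diagonal operators are given by $M_a.\langle F,I\rangle=\mu_a(F,I)\langle F,I\rangle$. *)

(* Defs.v *)
From HB Require Import structures.
From mathcomp Require Import all_boot all_order all_algebra finmap.
From mathcomp Require Import boolp classical_sets functions cardinality fsbigop.
From mathcomp Require Import reals complex monalg.

Set Implicit Arguments.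
Unset Strict Implicit.
Unset Printing Implicit Defensive.

Import Order.TTheory GRing.Theory Num.Theory.

Local Open Scope card_scope.
Local Open Scope classical_set_scope.
Local Open Scope ring_scope.

Section Posets.
Context {d : Order.disp_t} {P : porderType d}.
Implicit Types (A F : set P) (x y z : P).

Definition locally_finite := forall x y, finite_set [set z | (x <= z <= y)%O].

Definition minimal_in A x := A x /\ forall y, A y -> (y <= x)%O -> y = x.

Definition maximal_in A x := A x /\ forall y, A y -> (x <= y)%O -> y = x.

Definition covered_by x y := (x < y)%O /\ ~ exists z, (x < z < y)%O.

Definition neighbors x y := covered_by x y \/ covered_by y x.

Definition upward_closed F := forall x y, F x -> (x <= y)%O -> F y.

Definition is_split (FI : set P * set P) :=
  upward_closed FI.1 /\ FI.2 = ~` FI.1.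

End Posets.

Arguments locally_finite {d} P.

Record FIsplit d (P : porderType d) := MkSplit {
  split_pair : set P * set P;
  split_pairP : `[< is_split split_pair >] }.

HB.instance Definition _ d (P : porderType d) :=
  [isSub for @split_pair d P].
HB.instance Definition _ d (P : porderType d) :=
  [Choice of FIsplit P by <:].

Section Splits.
Context {d : Order.disp_t} {P : porderType d}.
Implicit Types (s : FIsplit P) (x y : P).

Definition filter_part s : set P := (split_pair s).1.

Definition ideal_part s : set P := (split_pair s).2.

(* (F - x, I + x); the default value s is never used when x is minimal in F,
   see to_idealE. *)
Definition to_ideal s x : FIsplit P :=
  insubd s (filter_part s `\ x, ideal_part s `|` [set x]).

(* (F + y, I - y), for y maximal in I, see to_filterE. *)
Definition to_filter s y : FIsplit P :=
  insubd s (filter_part s `|` [set y], ideal_part s `\ y).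

Lemma splitP s :
  upward_closed (filter_part s) /\ ideal_part s = ~` filter_part s.
Proof. exact: asboolW (split_pairP s). Qed.

Lemma to_idealE s x : minimal_in (filter_part s) x ->
  split_pair (to_ideal s x) = (filter_part s `\ x, ideal_part s `|` [set x]).
Proof.
case=> _ minx; have [Fup IE] := splitP s.
rewrite -[split_pair _]/(val _) val_insubd ifT//; apply/asboolP; split => /=.
  move=> y z [Fy yx] yz; split; first exact: Fup yz.
  by move=> zx; rewrite zx in yz; apply: yx; exact: minx.
by rewrite IE setDE setCI setCK.
Qed.

Lemma to_filterE s y : maximal_in (ideal_part s) y ->
  split_pair (to_filter s y) = (filter_part s `|` [set y], ideal_part s `\ y).
Proof.
case=> _ maxy; have [Fup IE] := splitP s.
rewrite -[split_pair _]/(val _) val_insubd ifT//; apply/asboolP; split => /=.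
  move=> u v [Fu uv|-> yv]; first by left; exact: Fup uv.
  have [Fv|nFv] := pselect (filter_part s v); first by left.
  by right; apply: maxy => //; rewrite IE.
by rewrite IE setCU setDE.
Qed.

End Splits.

Section LinearExtension.
Variables (K : nzRingType) (B : choiceType) (W : lmodType K).

Definition lin_ext (f : B -> W) (v : {malg K[B]}) : W :=
  \sum_(b <- msupp v) v@_b *: f b.

Lemma lin_extEw f v (D : {fset B}) : (msupp v `<=` D)%fset ->
  lin_ext f v = \sum_(b <- D) v@_b *: f b.
Proof.
move=> sub; rewrite /lin_ext (big_fset_incl _ sub)//.
by move=> b _ /mcoeff_outdom ->; rewrite scale0r.
Qed.

Lemma lin_ext_is_linear f : linear (lin_ext f).
Proof.
move=> c u v; pose D := (msupp u `|` msupp v)%fset.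
have subD : (msupp (c *: u + v) `<=` D)%fset.
  apply: fsubset_trans (msuppD_le _ _) _.
  by apply: fsetSU; exact: msuppZ_le.
rewrite (lin_extEw f subD) (lin_extEw f (fsubsetUl _ _ : _ `<=` D)%fset).
rewrite (lin_extEw f (fsubsetUr _ _ : _ `<=` D)%fset).
rewrite scaler_sumr -big_split; apply: eq_bigr => b _ /=.
by rewrite mcoeffD mcoeffZ scalerDl scalerA.
Qed.

HB.instance Definition _ f :=
  GRing.isLinear.Build K {malg K[B]} W *:%R (lin_ext f) (lin_ext_is_linear f).

Lemma lin_extU f b : lin_ext f << b >> = f b.
Proof. by rewrite /lin_ext msuppU oner_eq0 big_seq_fset1 mcoeffUU scale1r. Qed.

End LinearExtension.

Section Coloring.
Context {Gamma : finType} (adj : rel Gamma) {d : Order.disp_t}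
  {P : porderType d} (kappa : P -> Gamma).
Implicit Types (a b c : Gamma) (x y z : P) (s : FIsplit P).

Definition distant a b := (a != b) && ~~ adj a b.

Definition theta a b : int :=
  if a == b then 2 else if adj a b then -1 else 0.

Definition colored a : set P := [set x | kappa x = a].

Definition EC := forall x y, kappa x = kappa y -> (x >=< y)%O.

Definition NA := forall x y, neighbors x y -> adj (kappa x) (kappa y).

Definition AC := forall x y, adj (kappa x) (kappa y) -> (x >=< y)%O.

Definition I2A := forall a x y,
  colored a x -> colored a y -> (x < y)%O ->
  (~ exists2 z, colored a z & (x < z < y)%O) ->
  [set z | (x < z < y)%O /\ adj (kappa z) a] #= `I_2.

Definition Mx1GA := forall a x, maximal_in (colored a) x ->
  is_subset1 [set z | (x < z)%O /\ adj (kappa z) a].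

Definition Mn1LA := forall a x, minimal_in (colored a) x ->
  is_subset1 [set z | (z < x)%O /\ adj (kappa z) a].

Definition min_of_color a s : set P :=
  [set x | minimal_in (filter_part s) x /\ kappa x = a].

Definition max_of_color a s : set P :=
  [set y | maximal_in (ideal_part s) y /\ kappa y = a].

(* The elements of P_c /\ I greater than y, and those of P_c /\ F less
   than y. *)
Definition ideal_above c s y : set P :=
  [set z | [/\ colored c z, ideal_part s z & (y < z)%O]].

Definition filter_below c s y : set P :=
  [set z | [/\ colored c z, filter_part s z & (z < y)%O]].

Definition Upsilon b s y : set P :=
  [set z | [/\ ideal_part s z, (y < z)%O, adj (kappa z) b
             & finite_set (ideal_above (kappa z) s y)]].

Definition Psi b s y : set P :=
  [set z | [/\ filter_part s z, (z < y)%O, adj (kappa z) b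
             & finite_set (filter_below (kappa z) s y)]].

(* upsilon, psi and mu are meant for posets satisfying EC: then the maximal
   (minimal) element y chosen below is unique. *)
Definition upsilon b s : nat :=
  match pselect (exists y, maximal_in (colored b `&` ideal_part s) y) with
  | left ex =>
      let y := projT1 (cid ex) in
      if `[< exists2 a, adj a b & infinite_set (ideal_above a s y) >]
      then (#|` fset_set (Upsilon b s y)|).+1
      else #|` fset_set (Upsilon b s y)|
  | right _ => 1%N
  end.

Definition psi b s : nat :=
  match pselect (exists y, minimal_in (colored b `&` filter_part s) y) with
  | left ex =>
      let y := projT1 (cid ex) in
      if `[< exists2 a, adj a b & infinite_set (filter_below a s y) >]
      then (#|` fset_set (Psi b s y)|).+1
      else #|` fset_set (Psi b s y)|
  | right _ => 1%N
  end.

Definition mu b s : int :=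
  if `[< colored b `&` ideal_part s !=set0 >] then 1 - (upsilon b s)%:Z
  else -1 + (psi b s)%:Z.

End Coloring.

Section Representations.
Variable R : realType.
Context {Gamma : finType} (adj : rel Gamma) {d : Order.disp_t}
  {P : porderType d} (kappa : P -> Gamma).

Local Notation C := R[i].

(* The free complex vector space <FI(P)>, with basis the vectors basis_vec s;
   only the module structure of {malg _} is used. *)
Local Notation V := {malg C[FIsplit P]}.
Local Notation ops := (Gamma -> {linear V -> V}).

Implicit Types (a b : Gamma) (s : FIsplit P) (x y h H : ops).

Definition basis_vec s : V := << s >>.

(* A sum over an infinite set evaluates to 0, so that the operators X_a
   and Y_a are meaningful only under X_defined and Y_defined; these are
   part of every assertion about them below. *)
Definition X_op : ops := fun a =>
  lin_ext (fun s => \sum_(x \in min_of_color kappa a s) basis_vec (to_ideal s x)).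

Definition Y_op : ops := fun a =>
  lin_ext (fun s => \sum_(y \in max_of_color kappa a s) basis_vec (to_filter s y)).

Definition X_defined := forall a s, finite_set (min_of_color kappa a s).

Definition Y_defined := forall a s, finite_set (max_of_color kappa a s).

Definition M_op : ops := fun a =>
  lin_ext (fun s => (mu adj kappa a s)%:~R *: basis_vec s).

Definition diagonal (T : V -> V) :=
  forall s, exists c : C, T (basis_vec s) = c *: basis_vec s.

Definition bracket (f g : V -> V) : V -> V := (f \o g) - (g \o f).

Definition serre x :=
  (forall a b, distant adj a b -> bracket (x b) (x a) = 0) /\
  (forall a b, bracket (x a) (bracket (x a) (x b)) = 0).

Definition rel_HH h := forall a b, bracket (h b) (h a) = 0.

Definition rel_HX h x := forall a b,
  bracket (h b) (x a) = (x a : V -> V) *~ theta adj a b.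

Definition rel_HY h y := forall a b,
  bracket (h b) (y a) = (y a : V -> V) *~ (- theta adj a b).

Definition rel_XY x y h :=
  (forall a, bracket (x a) (y a) = h a) /\
  (forall a b, a != b -> bracket (x b) (y a) = 0).

Definition rep_bplus H :=
  [/\ X_defined, forall a, diagonal (H a),
      serre X_op, rel_HH H & rel_HX H X_op].

Definition rep_bminus H :=
  [/\ Y_defined, forall a, diagonal (H a),
      serre Y_op, rel_HH H & rel_HY H Y_op].

Definition rep_g H :=
  [/\ X_defined /\ Y_defined, forall a, diagonal (H a),
      serre X_op /\ serre Y_op,
      [/\ rel_HH H, rel_HX H X_op & rel_HY H Y_op]
    & rel_XY X_op Y_op H].

Definition square_nilpotent x := forall a, (x a : V -> V) \o x a = 0.

Definition eigenvalue_set H : set C :=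
  [set c | exists a s, H a (basis_vec s) = c *: basis_vec s].

Definition upper_minuscule H :=
  [/\ rep_bplus H, square_nilpotent X_op,
      eigenvalue_set H `<=` [set n%:~R | n in [set n : int | -1 <= n]]
    & forall s a, H a (basis_vec s) = - basis_vec s <-> min_of_color kappa a s !=set0].

Definition lower_minuscule H :=
  [/\ rep_bminus H, square_nilpotent Y_op,
      eigenvalue_set H `<=` [set n%:~R | n in [set n : int | n <= 1]]
    & forall s a, H a (basis_vec s) = basis_vec s <-> max_of_color kappa a s !=set0].

Definition g_minuscule H :=
  rep_g H /\ eigenvalue_set H `<=` [set -1; 0; 1].

Definition prescribed_values H := forall b s,
  [/\ min_of_color kappa b s !=set0 -> H b (basis_vec s) = - basis_vec s,
      max_of_color kappa b s !=set0 -> H b (basis_vec s) = basis_vec s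
    & ~ (min_of_color kappa b s !=set0) ->
      ~ (max_of_color kappa b s !=set0) ->
      H b (basis_vec s) = 0].

Definition upper_lower_rep H := upper_minuscule H /\ lower_minuscule H.

Definition prescribed_rep H :=
  [/\ rep_bplus H, rep_bminus H & prescribed_values H].

Definition nilpotent_rep H :=
  [/\ rep_bplus H /\ rep_bminus H,
      square_nilpotent X_op, square_nilpotent Y_op
    & forall a, bracket (X_op a) (Y_op a) = H a].

Definition unique_ops (Q : ops -> Prop) H :=
  Q H /\ forall H', Q H' -> forall a, H' a =1 H a.

End Representations.

Arguments upper_lower_rep R {Gamma} adj {d P} kappa H.
Arguments prescribed_rep R {Gamma} adj {d P} kappa H.
Arguments nilpotent_rep R {Gamma} adj {d P} kappa H.
Arguments g_minuscule R {Gamma} adj {d P} kappa H.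
Arguments M_op R {Gamma} adj {d P} kappa a.

Definition coloring_properties (Gamma : finType) (adj : rel Gamma) d
    (P : porderType d) (kappa : P -> Gamma) :=
  [/\ EC kappa, NA adj kappa, AC adj kappa
    & [/\ I2A adj kappa, Mx1GA adj kappa & Mn1LA adj kappa]].

(* Main.v *)
Require Import Defs.
From mathcomp Require Import all_boot all_order all_algebra finmap.
From mathcomp Require Import boolp classical_sets functions cardinality fsbigop.
From mathcomp Require Import reals complex monalg zify.

(** The four kinds of representations and the coloring properties are all
    equivalent to one combinatorial statement.  Give a split (F, I) and a color
    b the weight [weight b (F, I)], which is +1 if I has a maximal element of
    color b, -1 if F has a minimal element of color b, and 0 if neither (or
    both) occur.  The statement, [jump adj kappa (weight kappa)], says that
    moving an element of color a from F to I raises the weight of every color b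
    by theta_ab.

    Representations give jumps.  Relation HX says exactly that the eigenvalues
    of the H_b jump by theta_ab along such moves ([jump_of_HX]), so only the
    equality of eigenvalues and weights is at stake.  In (i) and (ii) it is read
    off the hypotheses.  Under EC a split has at most one move of each color in
    each direction, and then [X_a, Y_a] acts on a split by its weight
    ([bracket_XY_wt]); so in (iv) and (v) it is enough to derive EC.
    If two minimal elements of F had the same color, X_a^2 would not vanish, its
    matrix coefficients being sums of nonnegative integers ([EC_of_nilpotent]),
    and the eigenvalues would not be confined to {-1, 0, 1}, for they jump by 2
    ([EC_of_jump]).

    Jumps give the coloring properties.  EC, AC and NA follow by moving one
    well-chosen element.  For I2A and the two extremal properties, move all
    elements of a finite set containing no element of color b, one after the
    other: the weight of b drops by the number of elements of that set whose
    color is adjacent to b ([wt_span]).  Between consecutive elements of color b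
    it drops from 1 to -1, hence by 2; above the last or below the first element
    of color b, a drop by 2 would create an element of color b that is not there.

    The coloring properties give jumps, and mu.  Let y be the last element of
    color b in I.  Then the weight of b is 1 minus the number of elements of I
    above y whose color is adjacent to b ([wt_above]), and dually when I has no
    element of color b ([wt_below]).  I2A and
    the extremal properties bound these numbers by 2, so the sets in the
    definition of mu are finite and mu is the weight ([mu_wt]).  It also makes plain that moving an element of a color adjacent
    to b lowers the weight by one ([wt_adjacent_step]).

    Jumps give representations.  Under EC the operators X_a and Y_a send each
    basis vector to a basis vector or to 0, so every relation becomes a statement
    about chains of moves, and those follow from the values of the weights at
    the ends of a move ([no_step_twice], [no_step_aba], [distant_steps]). *)

Set Implicit Arguments.
Unset Strict Implicit.
Unset Printing Implicit Defensive.

Import Order.TTheory GRing.Theory Num.Theory.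

Local Open Scope card_scope.
Local Open Scope classical_set_scope.
Local Open Scope ring_scope.

(** * Locally finite posets *)

Lemma finite_maximal d (P : porderType d) (A : set P) x :
  finite_set A -> A x -> exists2 m, maximal_in A m & (x <= m)%O.
Proof.
move=> /finite_seqP[s ->] /= xs.
suff [m [xm ms maxm]] : exists m,
    [/\ (x <= m)%O, m \in x :: s & forall z, z \in s -> ~~ (m < z)%O].
  exists m => //; split=> [|z /= zs].
    by move: ms; rewrite inE => /orP[/eqP->|].
  by rewrite le_eqVlt (negbTE (maxm _ zs)) orbF => /eqP.
elim: s x {xs} => [|y s IH] x; first by exists x; rewrite lexx inE eqxx.
have [m [xm ms maxm]] := IH x.
have [ltmy|nltmy] := boolP (m < y)%O.
  have [n [yn ns maxn]] := IH y; exists n; split.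
  - exact: le_trans xm (le_trans (ltW ltmy) yn).
  - by rewrite inE ns orbT.
  - by move=> z; rewrite inE => /orP[/eqP->|/maxn//]; rewrite le_gtF.
exists m; split=> //.
  by move: ms; rewrite !inE => /orP[->//|->]; rewrite !orbT.
by move=> z; rewrite inE => /orP[/eqP->|/maxm].
Qed.

Lemma finite_minimal d (P : porderType d) (A : set P) x :
  finite_set A -> A x -> exists2 m, minimal_in A m & (m <= x)%O.
Proof. exact: (@finite_maximal _ P^d). Qed.

Lemma card_I2P (T : choiceType) (A : set T) :
  A #= `I_2 <-> exists x y, x <> y /\ A = [set x; y].
Proof.
split=> [/eq_cardSP[x Ax /eq_cardSP[y [Ay yx]]]|[x [y [xy ->]]]].
  rewrite II0 card_eq0 => /eqP A0; exists x, y; split; first by move=> xy; apply: yx.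
  apply/seteqP; split=> [z Az|z [->|->]//].
  have [->|zx] := pselect (z = x); first by left.
  have [->|zy] := pselect (z = y); first by right.
  by have : ((A `\ x) `\ y) z by []; rewrite A0.
apply/eq_cardSP; exists x; first by left.
apply/eq_cardSP; exists y; first by split; [right|move=> yx; apply: xy].
by rewrite II0 card_eq0; apply/eqP/seteqP; split=> // z [[[]]].
Qed.

Lemma subset1P (T : Type) (A : set T) : is_subset1 A -> A = set0 \/ exists u, A = [set u].
Proof.
move=> A1; have [->|/set0P[u Au]] := eqVneq A set0; [by left|right].
by exists u; apply/seteqP; split=> [v Av|v ->//]; exact: A1.
Qed.

Section LocallyFinite.
Context {d : Order.disp_t} {P : porderType d} (P_lf : locally_finite P).
Implicit Types (A : set P) (x y z : P).

Lemma locally_finite_sub A x y :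
  A `<=` [set z | (x <= z <= y)%O] -> finite_set A.
Proof. by move=> /sub_finite_set; apply; exact: P_lf. Qed.

Lemma cover_above x y : (x < y)%O -> exists2 z, covered_by x z & (z <= y)%O.
Proof.
move=> xy; pose A := [set z | (x < z <= y)%O].
have finA : finite_set A.
  by apply: (@locally_finite_sub _ x y) => z /= /andP[/ltW-> ->].
have [|m [/andP[xm my] minm] _] := @finite_minimal _ _ A y finA.
  by rewrite /A /= xy lexx.
exists m => //; split=> // -[z /andP[xz zm]].
have : z = m by apply: minm (ltW zm); rewrite /A/= xz (le_trans (ltW zm)).
by move=> zmE; rewrite zmE ltxx in zm.
Qed.

Lemma cover_below x y : (x < y)%O -> exists2 z, covered_by z y & (x <= z)%O.
Proof.
move=> xy; pose A := [set z | (x <= z < y)%O].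
have finA : finite_set A.
  by apply: (@locally_finite_sub _ x y) => z /= /andP[-> /ltW->].
have [|m [/andP[xm my] maxm] _] := @finite_maximal _ _ A x finA.
  by rewrite /A /= xy lexx.
exists m => //; split=> // -[z /andP[mz zy]].
have : z = m by apply: maxm (ltW mz); rewrite /A/= zy (le_trans xm (ltW mz)).
by move=> zmE; rewrite zmE ltxx in mz.
Qed.

End LocallyFinite.

(** * Moving one element from the filter to the ideal *)

Section Splits.
Context {d : Order.disp_t} {P : porderType d}.
Implicit Types (s t u : FIsplit P) (x y z : P).

Lemma filter_up s x y : filter_part s x -> (x <= y)%O -> filter_part s y.
Proof. by have [+ _] := Defs.splitP s; apply. Qed.

Lemma idealE s x : ideal_part s x <-> ~ filter_part s x.
Proof. by have [_ ->] := Defs.splitP s. Qed.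

Lemma ideal_down s x y : ideal_part s y -> (x <= y)%O -> ideal_part s x.
Proof.
by rewrite !idealE => Iy xy Fx; apply: Iy; exact: filter_up xy.
Qed.

Lemma split_inj s t :
  (forall z, filter_part s z <-> filter_part t z) -> s = t.
Proof.
move=> st; apply: val_inj; have [_] := Defs.splitP s; have [_] := Defs.splitP t.
rewrite /ideal_part /filter_part in st *.
move: st; rewrite -[split_pair s]/(val s) -[split_pair t]/(val t).
case: (val s) => Fs Is; case: (val t) => Ft It /= st -> ->.
by have -> : Fs = Ft by apply/seteqP; split=> z; rewrite st.
Qed.

Lemma split_of_filter (F : set P) :
  upward_closed F -> exists s, filter_part s = F.
Proof.
move=> upF; have FI : `[< is_split (F, ~` F) >] by exact/asboolP.
by exists (MkSplit FI).
Qed.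

(** The split t is (F - x, I + x) where s is (F, I).  As a relation it serves
    X and Y at once, since t determines s as much as s determines t.  The filter
    of t being upward closed, x is minimal in F and maximal in I + x. *)
Definition adds x s t :=
  filter_part s x /\ forall z, filter_part t z <-> filter_part s z /\ z <> x.

Lemma adds_minimal x s t : adds x s t -> minimal_in (filter_part s) x.
Proof.
move=> [Fx st]; split=> // y Fy yx; apply: contrapT => nyx.
by have /(filter_up)/(_ yx)/st[_] : filter_part t y by exact/st.
Qed.

Lemma adds_maximal x s t : adds x s t -> maximal_in (ideal_part t) x.
Proof.
move=> [Fx st]; split=> [|y /idealE Iy xy]; first by apply/idealE => /st[].
by apply: contrapT => nyx; apply: Iy; apply/st; split=> //; exact: filter_up xy.
Qed.

Lemma adds_to_ideal x s : minimal_in (filter_part s) x -> adds x s (to_ideal s x).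
Proof.
by move=> minx; split=> [|z]; [case: minx|rewrite /filter_part to_idealE].
Qed.

Lemma adds_to_filter x s : maximal_in (ideal_part s) x -> adds x (to_filter s x) s.
Proof.
move=> maxx; split=> [|z]; rewrite /filter_part to_filterE//=; first by right.
split=> [Fz|[[]//]]; split; first by left.
by case: maxx => /idealE + _ zx; rewrite -zx.
Qed.

Lemma adds_fun x s t t' : adds x s t -> adds x s t' -> t = t'.
Proof. by move=> [_ st] [_ st']; apply: split_inj => z; rewrite st st'. Qed.

Lemma adds_inj x s s' t : adds x s t -> adds x s' t -> s = s'.
Proof.
move=> [Fx st] [Fx' st']; apply: split_inj => z.
have [->//|zx] := pselect (z = x).
by split=> Fz; [have /st'[] : filter_part t z by apply/st|
                have /st[] : filter_part t z by apply/st'].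
Qed.

Lemma adds_elt x y s t : adds x s t -> adds y s t -> x = y.
Proof.
move=> [Fx st] [Fy st']; apply: contrapT => xy.
by have /st[] : filter_part t x by apply/st'.
Qed.

End Splits.

(** * Weights of splits *)

Section Weights.
Context {Gamma : finType} (adj : rel Gamma) {d : Order.disp_t}
  {P : porderType d} (kappa : P -> Gamma).
Implicit Types (a b c : Gamma) (x y z : P) (s t : FIsplit P).

Definition step a s t := exists2 x, adds x s t & kappa x = a.

Definition has_min b s := min_of_color kappa b s !=set0.
Definition has_max b s := max_of_color kappa b s !=set0.

Definition weight b s : int := `[< has_max b s >]%:Z - `[< has_min b s >]%:Z.

Local Notation wt := weight.

(** The combinatorial content of relation HX, and of HY, for diagonal operators
    with eigenvalues f. *)
Definition jump (f : Gamma -> FIsplit P -> int) :=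
  forall a b s t, step a s t -> f b t = f b s + theta adj a b.

Lemma has_min_step b s : has_min b s <-> exists t, step b s t.
Proof.
split=> [[x [minx xb]]|[t [x sxt xb]]].
  by exists (to_ideal s x), x => //; exact: adds_to_ideal.
by exists x; split=> //; exact: adds_minimal sxt.
Qed.

Lemma has_max_step b t : has_max b t <-> exists s, step b s t.
Proof.
split=> [[x [maxx xb]]|[s [x sxt xb]]].
  by exists (to_filter t x), x => //; exact: adds_to_filter.
by exists x; split=> //; exact: adds_maximal sxt.
Qed.

Lemma wt_has_min b s : wt b s = -1 -> has_min b s /\ ~ has_max b s.
Proof. by rewrite /weight; case: asboolP; case: asboolP. Qed.

Lemma wt_has_max b s : wt b s = 1 -> has_max b s /\ ~ has_min b s.
Proof. by rewrite /weight; case: asboolP; case: asboolP. Qed.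

Lemma wt_range b s : [\/ wt b s = -1, wt b s = 0 | wt b s = 1].
Proof.
by rewrite /weight; case: asboolP; case: asboolP => _ _;
  [constructor 2|constructor 3|constructor 1|constructor 2].
Qed.

Lemma theta_refl a : theta adj a a = 2.
Proof. by rewrite /theta eqxx. Qed.

(** A jump by theta_aa = 2 inside {-1, 0, 1} can only go from -1 to 1.  Nearly
    every argument about chains of moves below is an application of this. *)
Lemma jump_ends f a s t :
    jump f -> (forall b u, -1 <= f b u <= 1) -> step a s t ->
  f a s = -1 /\ f a t = 1.
Proof.
move=> jf fb ast; have := jf _ a _ _ ast; have := fb a s; have := fb a t.
by rewrite theta_refl; lia.
Qed.

Lemma step_of_min a x s : minimal_in (filter_part s) x -> kappa x = a ->
  step a s (to_ideal s x).
Proof. by exists x => //; exact: adds_to_ideal. Qed.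

Lemma adds_stays_minimal x y s t :
    adds x s t -> minimal_in (filter_part s) y -> y <> x ->
  minimal_in (filter_part t) y.
Proof.
move=> [Fx st] [Fy miny] yx; split; first exact/st.
by move=> z /st[Fz zx]; exact: miny.
Qed.

Lemma adds_stays_maximal x y s t :
    adds x s t -> maximal_in (ideal_part t) y -> y <> x ->
  maximal_in (ideal_part s) y.
Proof.
move=> [Fx st] [/idealE Iy maxy] yx; split.
  by apply/idealE => Fy; apply: Iy; exact/st.
move=> z /idealE Iz yz; apply: maxy => //; apply/idealE => /st[Fz _].
exact: Iz.
Qed.

(** If x and y are incomparable, this is the filter in which both are minimal;
    EC and AC are tested on it. *)
Lemma generated_filter x y : exists s, filter_part s = [set z | (x <= z)%O \/ (y <= z)%O].
Proof.
apply: split_of_filter => u v /= uu uv.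
by case: uu => [xu|yu]; [left; exact: le_trans uv|right; exact: le_trans uv].
Qed.

Lemma incomparable_minimal x y s : ~~ (x >=< y)%O ->
    filter_part s = [set z | (x <= z)%O \/ (y <= z)%O] ->
  minimal_in (filter_part s) x /\ minimal_in (filter_part s) y.
Proof.
move=> nxy ->; split; split=> /=.
- by left.
- move=> z [xz zx|yz zx]; first by apply/eqP; rewrite eq_le zx.
  by case/negP: nxy; rewrite /Order.comparable (le_trans yz zx) orbT.
- by right.
- move=> z [xz zy|yz zy]; last by apply/eqP; rewrite eq_le zy.
  by case/negP: nxy; rewrite /Order.comparable (le_trans xz zy).
Qed.

Lemma EC_of_unique_min :
    (forall a s x y, min_of_color kappa a s x -> min_of_color kappa a s y -> x = y) ->
  EC kappa.
Proof.
move=> uniq_min x y xy; apply: contrapT => /negP nxy.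
have [s sE] := generated_filter x y.
have [mx my] := incomparable_minimal nxy sE.
have xyE : x = y by apply: (uniq_min (kappa y) s).
by move: nxy; rewrite xyE comparablexx.
Qed.

(** If x and y are minimal in F with a common color, the value after moving x
    is 1 as the end of that move, and -1 as the start of the move of y. *)
Lemma EC_of_jump f : jump f -> (forall b u, -1 <= f b u <= 1) -> EC kappa.
Proof.
move=> jf fb; apply: EC_of_unique_min => a s x y [mx xa] [my ya].
apply: contrapT => xy.
have sxt := adds_to_ideal mx.
have my' := adds_stays_minimal sxt my (nesym xy).
have [_ f1] := jump_ends jf fb (step_of_min mx xa).
by have [] := jump_ends jf fb (step_of_min my' ya); rewrite f1.
Qed.

Lemma min_unique x y s : EC kappa -> minimal_in (filter_part s) x ->
  minimal_in (filter_part s) y -> kappa x = kappa y -> x = y.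
Proof.
move=> EC [Fx minx] [Fy miny] /EC/orP[xy|yx]; first exact: miny.
by apply/esym; exact: minx.
Qed.

Lemma max_unique x y s : EC kappa -> maximal_in (ideal_part s) x ->
  maximal_in (ideal_part s) y -> kappa x = kappa y -> x = y.
Proof.
move=> EC [Fx maxx] [Fy maxy] /EC/orP[xy|yx]; last exact: maxy.
by apply/esym; exact: maxx.
Qed.

(** * Weights that jump by theta force the coloring properties *)

Section JumpToColoring.
Hypotheses (adj_irr : irreflexive adj) (adj_sym : symmetric adj)
  (P_lf : locally_finite P) (jw : jump wt).

Let wt_bnd b u : -1 <= wt b u <= 1.
Proof. by case: (wt_range b u) => ->. Qed.

Let wt_ends a s t : step a s t -> wt a s = -1 /\ wt a t = 1.
Proof. exact: jump_ends. Qed.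

Let ECk : EC kappa. Proof. exact: EC_of_jump wt_bnd. Qed.

Lemma wt_min a s : has_min a s -> wt a s = -1.
Proof. by move=> /has_min_step[t /wt_ends[]]. Qed.

Lemma wt_max a s : has_max a s -> wt a s = 1.
Proof. by move=> /has_max_step[t /wt_ends[]]. Qed.

(** If x and y were incomparable, y would still be minimal after the move of x,
    so the weight of its color would be -1 both before and after a move that
    lowers it by one. *)
Lemma AC_of_jump : Defs.AC adj kappa.
Proof.
move=> x y xy; apply: contrapT => /negP nxy.
have [s sE] := generated_filter x y.
have [mx my] := incomparable_minimal nxy sE.
have yx : y <> x by move=> yx; move: nxy; rewrite yx comparablexx.
have sxt := step_of_min mx erefl.
have my' := adds_stays_minimal (adds_to_ideal mx) my yx.
have := jw (kappa y) sxt.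
rewrite !wt_min; [|by exists y; split..].
have /negbTE nk : kappa x != kappa y.
  by apply: contraTneq xy => ->; rewrite adj_irr.
by rewrite /theta nk xy.
Qed.

(** Suppose that y covers x, with colors that are not adjacent.  They are distinct
    by [jump_ends], the moves of x and of y being consecutive in what follows:
    move x from the filter of all elements not below y, together with x.
    Afterwards y is minimal, so the weight of its color is -1; it was -1 before
    as well, so some w of the color of y was minimal already, and still is after
    the move.  Uniqueness gives w = y, which was not minimal. *)
Lemma NA_of_jump : NA adj kappa.
Proof.
suff cov x y : covered_by x y -> adj (kappa x) (kappa y).
  by move=> x y [/cov//|/cov]; rewrite adj_sym.
move=> [xy ncov]; apply: contrapT => /negP/negbTE nadj.
have [|s sE] := @split_of_filter _ P [set z | (z < y)%O -> z = x].
  move=> u v /= uu uv vy; have ux := uu (le_lt_trans uv vy); subst u.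
  move: uv; rewrite le_eqVlt => /orP[/eqP//|xv].
  by case: ncov; exists v; rewrite xv.
have mx : minimal_in (filter_part s) x.
  by rewrite sE; split=> // z /= + zx; apply; exact: le_lt_trans xy.
have sxt := adds_to_ideal mx.
have my : minimal_in (filter_part (to_ideal s x)) y.
  have [Fx st] := sxt; split.
    by apply/st; split; [rewrite sE /= ltxx|move=> yx; rewrite yx ltxx in xy].
  move=> z /st[]; rewrite sE /= => Fz zx; rewrite le_eqVlt.
  by move=> /orP[/eqP//|/Fz].
have my1 : wt (kappa y) (to_ideal s x) = -1 by apply: wt_min; exists y.
have sts := step_of_min mx erefl.
have [kxy|/negbTE kxy] := eqVneq (kappa x) (kappa y).
  by have [_] := wt_ends sts; rewrite kxy my1.
have := jw (kappa y) sts; rewrite my1 /theta kxy nadj addr0 => /esym.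
move=> /wt_has_min[[w [mw wy]] _].
have wx : w <> x by move=> wx; rewrite -wy wx eqxx in kxy.
have mw' := adds_stays_minimal sxt mw wx.
have wyE : w = y by exact: min_unique ECk mw' my wy.
have [_ /(_ x mx.1)] := mw; rewrite wyE => /(_ (ltW xy)) xyE.
by rewrite xyE ltxx in xy.
Qed.

(** The elements of D can be moved one at a time, a minimal one first. *)
Lemma step_chain_weight b s t (D : {fset P}) :
    (forall z, filter_part s z <-> filter_part t z \/ z \in D) ->
    (forall z, z \in D -> ~ filter_part t z) ->
  wt b t = wt b s + \sum_(z <- D) theta adj (kappa z) b.
Proof.
have [n] := ubnP #|` D|; elim: n => // n IH in s D *; rewrite ltnS => Dn sD Dt.
have [D0|[x xD]] := fset_0Vmem D.
  rewrite D0 big_seq_fset0 addr0; congr wt; apply: split_inj => z.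
  by rewrite sD D0 inE; split=> [|[]//]; left.
have [m [mD minm] _] := finite_minimal (finite_fset D) xD.
have mF : minimal_in (filter_part s) m.
  split; first by apply/sD; right.
  move=> z /sD[Ftz zm|zD]; last exact: minm.
  by case: (Dt _ mD); exact: filter_up zm.
have [Fm st'] := adds_to_ideal mF.
have := IH (to_ideal s m) (D `\ m)%fset.
rewrite (big_fsetD1 m mD) /= => ->.
- by rewrite (jw b (step_of_min mF erefl)) addrA.
- by move: Dn; rewrite (cardfsD1 m) mD.
- move=> z; rewrite st' sD !inE; split=> [[[Ftz|zD] /eqP zm]|[Ftz|/andP[/eqP zm zD]]].
  + by left.
  + by right; rewrite zm.
  + by split; [left|move=> zm; apply: (Dt _ mD); rewrite -zm].
  + by split=> //; right.
- by move=> z; rewrite !inE => /andP[_]; exact: Dt.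
Qed.

Lemma sum_theta b (D : {fset P}) : (forall z, z \in D -> kappa z <> b) ->
  \sum_(z <- D) theta adj (kappa z) b = - #|` [fset z in D | adj (kappa z) b]%fset|%:Z.
Proof.
move=> Db; transitivity (\sum_(z <- D) (if adj (kappa z) b then -1 else 0 : int)).
  by apply: eq_fbigr => z zD _; rewrite /theta ifN//; apply/eqP; exact: Db.
rewrite -big_mkcond big_fset_condE /= card_fset_sum1 sumrN; congr (- _).
by rewrite -[RHS]natz natr_sum.
Qed.

(** Only the elements of D of a color adjacent to b contribute to the change of
    weight, each by -1. *)
Lemma wt_span b s t (D : set P) (N : {fset P}) :
    finite_set D -> (forall z, D z -> kappa z <> b) ->
    (forall z, filter_part s z <-> filter_part t z \/ D z) ->
    (forall z, D z -> ~ filter_part t z) ->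
    N = [fset z in fset_set D | adj (kappa z) b]%fset ->
  wt b s = wt b t + #|` N|%:Z.
Proof.
move=> finD Db sD Dt ->.
have inD z : z \in fset_set D <-> D z by rewrite in_fset_set// inE.
rewrite (@step_chain_weight b s t (fset_set D)) ?sum_theta ?subrK//.
- by move=> z /inD/Db.
- by move=> z; rewrite sD inD.
- by move=> z /inD/Dt.
Qed.

(** Move the whole open interval between x and y: before the move x is maximal
    in the ideal of elements below y and not above x, afterwards y is minimal in
    the filter, so the weight drops from 1 to -1. *)
Lemma I2A_of_jump : I2A adj kappa.
Proof.
move=> a x y xa ya xy noz.
have [|s sE] := @split_of_filter _ P [set z | (z < y)%O -> (x < z)%O].
  by move=> u v /= uu uv vy; apply: lt_le_trans (uu (le_lt_trans uv vy)) uv.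
have [|t tE] := @split_of_filter _ P [set z | ~ (z < y)%O].
  by move=> u v /= uu uv vy; apply: uu; exact: le_lt_trans uv vy.
pose D := [set z | (x < z < y)%O].
have finD : finite_set D.
  by apply: (@locally_finite_sub _ _ P_lf _ x y) => z /= /andP[/ltW-> /ltW->].
have inD z : z \in fset_set D = (x < z < y)%O.
  by rewrite in_fset_set//; apply/idP/idP; rewrite inE.
pose N := [fset z in fset_set D | adj (kappa z) a]%fset.
have : wt a s = wt a t + #|` N|%:Z.
  apply: (@wt_span a s t D) => //.
  - by move=> z /= Dz za; apply: noz; exists z.
  - move=> z; rewrite sE tE /D /=; have [zy|nzy] := boolP (z < y)%O.
      by rewrite andbT; split=> [/(_ isT)|[//|]]; [right|].
    by split=> // _; left.
  - by move=> z; rewrite tE /D /= => /andP[_ zy]; exact.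
rewrite wt_max; last first.
  exists x; split=> //; split=> [|w].
    by apply/idealE; rewrite sE /= ltxx => /(_ xy).
  move/idealE; rewrite sE le_eqVlt => + /orP[/eqP//|xw].
  by move=> nw; case: nw => _.
rewrite wt_min; last first.
  exists y; split=> //; split=> [|w]; first by rewrite tE /= ltxx.
  by rewrite tE /= le_eqVlt => nwy /orP[/eqP//|].
move=> N2; have <- : [set` N] = [set z | (x < z < y)%O /\ adj (kappa z) a].
  by apply/seteqP; split=> z /=; rewrite !inE inD; [move/andP|move=> [-> ->]].
by apply/card_eq_fsetP; lia.
Qed.

(** Starting from a split in which x is maximal in the ideal, move everything in
    (x, z1] and (x, z2].  The weight drops from 1 by at least 2, so it ends at
    -1 and the filter has a minimal element w of color a.  By EC and the choice
    of x, w <= x, but x is in the ideal. *)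
Lemma Mx1GA_of_jump : Mx1GA adj kappa.
Proof.
move=> a x [xa maxx] z1 z2 /= [xz1 z1a] [xz2 z2a]; apply: contrapT => z12.
pose B := [set z | (z <= z1)%O \/ (z <= z2)%O].
have Bdown u v : B v -> (u <= v)%O -> B u.
  by move=> [vz|vz] uv; [left|right]; exact: le_trans vz.
have [|s sE] := @split_of_filter _ P [set z | B z -> (x < z)%O].
  by move=> u v /= uu uv Bv; apply: lt_le_trans (uu (Bdown _ _ Bv uv)) uv.
have [|t tE] := @split_of_filter _ P (~` B).
  by move=> u v /= uu uv Bv; apply: uu; exact: Bdown uv.
pose D := [set z | (x < z)%O /\ B z].
have finD : finite_set D.
  apply: (@sub_finite_set _ _
      ([set z | (x <= z <= z1)%O] `|` [set z | (x <= z <= z2)%O])).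
    by move=> z [/ltW xz [zz|zz]]; [left|right]; rewrite /= xz zz.
  by rewrite finite_setU; split; exact: P_lf.
pose N := [fset z in fset_set D | adj (kappa z) a]%fset.
have ws : wt a s = wt a t + #|` N|%:Z.
  apply: (@wt_span a s t D) => //.
  - by move=> z /= [xz _] za; have zx := maxx z za (ltW xz); rewrite zx ltxx in xz.
  - move=> z; rewrite sE tE /D /=.
    have [Bz|nBz] := pselect (B z); last by split=> // _; left.
    by split=> [/(_ Bz) xz|[//|[]//]]; right.
  - by move=> z; rewrite tE /= => -[_ Bz]; exact.
have Bx : B x by left; exact: ltW.
rewrite (@wt_max a s) in ws; last first.
  exists x; split=> //; split=> [|w].
    by apply/idealE; rewrite sE /= ltxx => /(_ Bx).
  move/idealE; rewrite sE le_eqVlt => + /orP[/eqP//|xw].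
  by move=> nw; case: nw => _.
have N2 : (2 <= #|` N|)%N.
  have <- : #|` [fset z1; z2]%fset| = 2%N by rewrite cardfs2; case: eqP.
  apply: fsubset_leq_card; apply/fsubsetP => z; rewrite !inE => /orP[/eqP->|/eqP->].
    by rewrite z1a andbT in_fset_set// inE; split=> //; left.
  by rewrite z2a andbT in_fset_set// inE; split=> //; right.
have wt1 : wt a t = -1 by move: (wt_bnd a t) ws; lia.
have [[w [[Fw _] wa]] _] := wt_has_min wt1.
move: Fw; rewrite tE; apply; have /orP[xw|wx] : (x >=< w)%O by apply: ECk; rewrite xa.
  by rewrite (maxx w).
exact: Bdown wx.
Qed.

(** Dually, end at a split in which x is minimal in the filter, of weight -1;
    before the elements of [z1, x) and [z2, x) were moved, the weight was 1 and the
    ideal had a maximal element of color a. *)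
Lemma Mn1LA_of_jump : Mn1LA adj kappa.
Proof.
move=> a x [xa minx] z1 z2 /= [z1x z1a] [z2x z2a]; apply: contrapT => z12.
pose B := [set z | (z1 <= z)%O \/ (z2 <= z)%O].
have Bup u v : B u -> (u <= v)%O -> B v.
  by move=> [vz|vz] uv; [left|right]; exact: le_trans uv.
have [|s sE] := @split_of_filter _ P B; first exact: Bup.
have [|t tE] := @split_of_filter _ P [set z | B z /\ ~ (z < x)%O].
  move=> u v /= [Bu ux] uv; split; first exact: Bup uv.
  by move=> vx; apply: ux; exact: le_lt_trans vx.
pose D := [set z | (z < x)%O /\ B z].
have finD : finite_set D.
  apply: (@sub_finite_set _ _
      ([set z | (z1 <= z <= x)%O] `|` [set z | (z2 <= z <= x)%O])).
    by move=> z [/ltW xz [zz|zz]]; [left|right]; rewrite /= xz zz.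
  by rewrite finite_setU; split; exact: P_lf.
pose N := [fset z in fset_set D | adj (kappa z) a]%fset.
have ws : wt a s = wt a t + #|` N|%:Z.
  apply: (@wt_span a s t D) => //.
  - by move=> z /= [xz _] za; have zx := minx z za (ltW xz); rewrite zx ltxx in xz.
  - move=> z; rewrite sE tE /D /=; have [zx|nzx] := boolP (z < x)%O.
      by split=> [|[[]|[]]//]; right.
    by split=> [|[[]|[]]//]; left.
  - by move=> z; rewrite tE /= => -[xz _] [_]; exact.
have Bx : B x by left; exact: ltW.
rewrite (@wt_min a t) in ws; last first.
  exists x; split=> //; rewrite tE; split=> /= [|w [_]].
    by split=> //; rewrite ltxx.
  by rewrite le_eqVlt => nwx /orP[/eqP//|].
have N2 : (2 <= #|` N|)%N.
  have <- : #|` [fset z1; z2]%fset| = 2%N by rewrite cardfs2; case: eqP.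
  apply: fsubset_leq_card; apply/fsubsetP => z; rewrite !inE => /orP[/eqP->|/eqP->].
    by rewrite z1a andbT in_fset_set// inE; split=> //; left.
  by rewrite z2a andbT in_fset_set// inE; split=> //; right.
have wt1 : wt a s = 1 by move: (wt_bnd a s) ws; lia.
have [[w [[/idealE Iw _] wa]] _] := wt_has_max wt1.
apply: Iw; rewrite sE; have /orP[xw|wx] : (x >=< w)%O by apply: ECk; rewrite xa.
  exact: Bup xw.
by rewrite (minx w).
Qed.

Lemma coloring_of_jump : coloring_properties adj kappa.
Proof.
split; [exact: ECk|exact: NA_of_jump|exact: AC_of_jump|split].
- exact: I2A_of_jump.
- exact: Mx1GA_of_jump.
- exact: Mn1LA_of_jump.
Qed.

End JumpToColoring.

End Weights.

(** * The coloring properties force the weights to jump by theta *)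

Section ColoringToJump.
Context {Gamma : finType} (adj : rel Gamma) {d : Order.disp_t}
  {P : porderType d} (kappa : P -> Gamma).
Implicit Types (a b c : Gamma) (x y z : P) (s t : FIsplit P).

Local Notation wt := (weight kappa).
Local Notation step := (step kappa).
Local Notation has_min := (has_min kappa).
Local Notation has_max := (has_max kappa).

(** Together with [adds_old_maximal]: moving x can expose or hide only neighbors
    of x, whose colors are adjacent to that of x by NA. *)
Lemma adds_new_minimal x y s t :
    adds x s t -> minimal_in (filter_part t) y ->
  minimal_in (filter_part s) y \/ covered_by x y.
Proof.
move=> [Fx st] [/st[Fy yx] miny].
have [xy|nxy] := boolP (x < y)%O; [right|left]; split=> //.
  move=> [z /andP[xz zy]].
  have zyE : z = y.
    apply: miny (ltW zy); apply/st; split; first exact: filter_up (ltW xz).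
    by move=> zx; rewrite zx ltxx in xz.
  by rewrite zyE ltxx in zy.
move=> z Fz zy; apply: miny => //; apply/st; split=> // zx; rewrite zx in zy.
by move: zy nxy; rewrite le_eqVlt => /orP[/eqP/nesym//|->].
Qed.

Lemma adds_old_maximal x y s t :
    adds x s t -> maximal_in (ideal_part s) y ->
  maximal_in (ideal_part t) y \/ covered_by y x.
Proof.
move=> sxt [Iy maxy]; have [Fx st] := sxt; have [/idealE Itx _] := adds_maximal sxt.
have It z : ideal_part t z -> z <> x -> ideal_part s z.
  by move=> /idealE Itz zx; apply/idealE => Fz; apply: Itz; apply/st.
have sI z : ideal_part s z -> ideal_part t z.
  by move=> /idealE Iz; apply/idealE => /st[].
have yx : y <> x by move=> yx; move/idealE: Iy; rewrite yx.
have [xy|nxy] := boolP (y < x)%O; [right|left]; split=> //.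
- move=> [z /andP[yz zx]].
  have zy : z = y.
    apply: maxy (ltW yz); apply: It => [|zxE]; last by rewrite zxE ltxx in zx.
    by apply: ideal_down (ltW zx); apply/idealE.
  by rewrite zy ltxx in yz.
- exact: sI.
move=> z Iz yz; apply: maxy => //; apply: It => // zx; rewrite zx in yz.
by move: yz nxy; rewrite le_eqVlt => /orP[/eqP//|->].
Qed.

Hypotheses (adj_irr : irreflexive adj) (P_lf : locally_finite P)
  (kappa_surj : forall a, exists x, kappa x = a)
  (ECk : EC kappa) (NAk : NA adj kappa) (ACk : Defs.AC adj kappa)
  (I2Ak : I2A adj kappa) (Mxk : Mx1GA adj kappa) (Mnk : Mn1LA adj kappa).

(** The sets whose cardinals give the weight; once they are known to be finite
    they coincide with the sets Upsilon and Psi in the definition of mu. *)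
Definition above b s y := [set z | [/\ ideal_part s z, (y < z)%O & adj (kappa z) b]].

Definition below b s y := [set z | [/\ filter_part s z, (z < y)%O & adj (kappa z) b]].

Definition last_in_ideal b s y := maximal_in (colored kappa b `&` ideal_part s) y.

Definition consecutive b x y := [/\ colored kappa b y, (x < y)%O &
  ~ exists2 z, colored kappa b z & (x < z < y)%O].

Lemma has_max_above b s y : last_in_ideal b s y -> has_max b s <-> above b s y = set0.
Proof.
move=> [[yb Iy] maxy]; split=> [[m [[Im maxm] mb]]|N0].
  have my : m = y.
    have /orP[my|ym] : (m >=< y)%O by apply: ECk; rewrite mb yb.
      by apply/esym; exact: maxm.
    exact: maxy.
  apply/seteqP; split=> // z [Iz yz _]; rewrite -my in yz.
  by move: (maxm _ Iz (ltW yz)) => zm; rewrite zm ltxx in yz.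
exists y; split=> //; split=> // z Iz; rewrite le_eqVlt => /orP[/eqP//|yz].
have [w yw wz] := cover_above P_lf yz.
suff : above b s y w by rewrite N0.
split; [exact: ideal_down wz|by case: yw|].
by rewrite -yb; apply: NAk; right.
Qed.

Lemma consecutive_in_filter b s y y2 :
  last_in_ideal b s y -> consecutive b y y2 -> filter_part s y2.
Proof.
move=> [_ maxy] [y2b yy2 _]; apply: contrapT => /idealE Iy2.
by have y2y := maxy y2 (conj y2b Iy2) (ltW yy2); rewrite y2y ltxx in yy2.
Qed.

(** A minimal element of F of color b must be the successor of y among the
    elements of color b, and it is minimal once everything between them whose
    color is adjacent to b has been moved to I. *)
Lemma has_min_consecutive b s y : last_in_ideal b s y ->
  has_min b s <-> exists2 y2, consecutive b y y2 &
    forall z, (y < z < y2)%O -> adj (kappa z) b -> ideal_part s z.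
Proof.
move=> lasty; have [[yb Iy] maxy] := lasty.
split=> [[m [[Fm minm] mb]]|[y2 cons2 A_I]].
  have ym : (y < m)%O.
    have /orP[my|] : (m >=< y)%O by apply: ECk; rewrite mb yb.
      by move/idealE: (ideal_down Iy my).
    by rewrite le_eqVlt => /orP[/eqP ym|//]; move/idealE: Iy; rewrite ym.
  have notF z : (z < m)%O -> ideal_part s z.
    move=> zm; apply/idealE => Fz.
    by have zmE := minm z Fz (ltW zm); rewrite zmE ltxx in zm.
  exists m => [|z /andP[_ /notF]//]; split=> // -[z zb /andP[yz zm]].
  by have zy := maxy z (conj zb (notF z zm)) (ltW yz); rewrite zy ltxx in yz.
have Fy2 := consecutive_in_filter lasty cons2; have [y2b yy2 _] := cons2.
exists y2; split=> //; split=> // z Fz; rewrite le_eqVlt => /orP[/eqP//|zy2].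
have [w wy2 zw] := cover_below P_lf zy2.
have wadj : adj (kappa w) b by rewrite -y2b; apply: NAk; left.
have Fw := filter_up Fz zw.
suff yw : (y < w)%O.
  have [ltwy2 _] := wy2.
  by have /idealE := A_I w (introT andP (conj yw ltwy2)) wadj.
have /orP[wy|] : (w >=< y)%O by apply: ACk; rewrite yb.
  by move/idealE: (ideal_down Iy wy).
by rewrite le_eqVlt => /orP[/eqP yw|//]; move/idealE: Iy; rewrite yw.
Qed.

Lemma consecutive_exists b y : colored kappa b y -> ~ maximal_in (colored kappa b) y ->
  exists y2, consecutive b y y2.
Proof.
move=> yb nmax.
have [z [zb yz]] : exists z, colored kappa b z /\ (y < z)%O.
  apply: contrapT => nex; apply: nmax; split=> // z zb.
  by rewrite le_eqVlt => /orP[/eqP//|yz]; case: nex; exists z.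
have finA : finite_set [set w | colored kappa b w /\ (y < w <= z)%O].
  by apply: (@locally_finite_sub _ _ P_lf _ y z) => w /= [_ /andP[/ltW-> ->]].
have [|m [[mb /andP[ym mz]] minm] _] := finite_minimal (x := z) finA.
  by rewrite /= yz lexx.
exists m; split=> // -[w wb /andP[yw wm]].
have wmE : w = m.
  by apply: minm (ltW wm); rewrite /= yw; split=> //; exact: ltW (lt_le_trans wm mz).
by rewrite wmE ltxx in wm.
Qed.

Lemma above_between b s y y2 z : last_in_ideal b s y -> consecutive b y y2 ->
  above b s y z <-> [/\ (y < z < y2)%O, adj (kappa z) b & ideal_part s z].
Proof.
move=> lasty cons2; have Fy2 := consecutive_in_filter lasty cons2.
have [y2b yy2 _] := cons2.
split=> [[Iz yz zb]|[/andP[yz zy2] zb Iz]]; last by split.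
split=> //; rewrite yz /=.
have /orP[] : (z >=< y2)%O by apply: ACk; rewrite y2b.
  by rewrite le_eqVlt => /orP[/eqP zy2|//]; move/idealE: Iz; rewrite zy2.
by move=> y2z; move/idealE: (ideal_down Iz y2z).
Qed.

Lemma wtE b s (M m : bool) : (has_max b s <-> M) -> (has_min b s <-> m) ->
  wt b s = M%:Z - m%:Z.
Proof.
move=> HM Hm; rewrite /weight.
have -> : `[< has_max b s >] = M by apply/asboolP/idP => /HM.
by have -> : `[< has_min b s >] = m by apply/asboolP/idP => /Hm.
Qed.

(** If y is the last element of color b in P, Mx1GA leaves room for at most one
    element above it, and F cannot have a minimal element of color b.
    Otherwise the candidates are the two elements p and q that I2A puts between y and
    its successor, and the weight is 1, 0 or -1 according as none, one or both of
    them lie in I. *)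
Lemma wt_above b s y : last_in_ideal b s y ->
  finite_set (above b s y) /\ wt b s = 1 - #|` fset_set (above b s y)|%:Z.
Proof.
move=> lasty; have [[yb Iy] maxy] := lasty.
have HM := has_max_above lasty; have Hm := has_min_consecutive lasty.
have [ymax|nymax] := pselect (maximal_in (colored kappa b) y).
  have nomin : ~ has_min b s.
    move=> /Hm[y2 [y2b yy2 _] _]; have y2y := ymax.2 y2 y2b (ltW yy2).
    by rewrite y2y ltxx in yy2.
  have [|N0|[x xE]] := @subset1P _ (above b s y).
  - by move=> u v [_ yu ub] [_ yv vb]; exact: (Mxk ymax).
  - rewrite N0 fset_set0 cardfs0; split=> //.
    by apply: (@wtE b s true false); split=> // _; apply/HM.
  - rewrite xE fset_set1 cardfs1; split=> //.
    apply: (@wtE b s false false); split=> //.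
    by move=> /HM; rewrite xE => /seteqP[/(_ x erefl)].
have [y2 cons2] := consecutive_exists yb nymax.
have [y2b yy2 nob] := cons2.
have [p [q [pq AE]]] := (card_I2P _).1 (I2Ak yb y2b yy2 nob).
have inA z : (y < z < y2)%O /\ adj (kappa z) b <-> z = p \/ z = q.
  by have := congr1 (fun A => A z) AE => /= ->.
have {}AB z : above b s y z <-> (z = p \/ z = q) /\ ideal_part s z.
  by rewrite (above_between z lasty cons2) -inA; split=> [[]|[[]]].
have Hm' : has_min b s <-> ideal_part s p /\ ideal_part s q.
  split=> [/Hm[y3 [y3b yy3 nob3] I3]|[Ip Iq]].
    have y23 : y3 = y2.
      have /orP[] : (y3 >=< y2)%O by apply: ECk; rewrite y2b.
        rewrite le_eqVlt => /orP[/eqP//|y32]; case: nob; exists y3 => //.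
        by rewrite yy3.
      rewrite le_eqVlt => /orP[/eqP//|y32]; case: nob3; exists y2 => //.
      by rewrite yy2.
    have [yp pb] := (inA p).2 (or_introl erefl).
    have [yq qb] := (inA q).2 (or_intror erefl).
    by rewrite y23 in I3; split; exact: I3.
  apply/Hm; exists y2 => // z yz zb.
  by have [->|->] := (inA z).1 (conj yz zb).
have HM' : has_max b s <-> ~ ideal_part s p /\ ~ ideal_part s q.
  rewrite HM; split=> [N0|[nIp nIq]].
    by split=> Ip; [have := (AB p).2 (conj (or_introl erefl) Ip)|
                    have := (AB q).2 (conj (or_intror erefl) Ip)]; rewrite N0.
  by apply/seteqP; split=> // z /AB[[->|->]].
have [Ip|nIp] := pselect (ideal_part s p); have [Iq|nIq] := pselect (ideal_part s q).
- have -> : above b s y = p |` [set q].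
    apply/seteqP; split=> z; rewrite AB; first by case.
    by case=> ->; split=> //; [left|right].
  rewrite fset_setU1// fset_set1 cardfs2; split; first by rewrite finite_setU.
  case: eqP => // _; apply: (@wtE b s false true); first by split=> // /HM'[].
  by split=> // _; exact/Hm'.
- have -> : above b s y = [set p].
    apply/seteqP; split=> z; rewrite AB; last by move=> ->; split=> //; left.
    by move=> [[->//|->]].
  rewrite fset_set1 cardfs1; split=> //.
  by apply: (@wtE b s false false); [split=> // /HM'[]|split=> // /Hm'[]].
- have -> : above b s y = [set q].
    apply/seteqP; split=> z; rewrite AB; last by move=> ->; split=> //; right.
    by move=> [[->|->//]].
  rewrite fset_set1 cardfs1; split=> //.
  by apply: (@wtE b s false false); [split=> // /HM'[]|split=> // /Hm'[]].
- have -> : above b s y = set0.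
    by apply/seteqP; split=> // z /AB[[->|->]].
  rewrite fset_set0 cardfs0; split=> //.
  by apply: (@wtE b s true false); [split=> // _; exact/HM'|split=> // /Hm'[]].
Qed.

(** All elements of color b being in F, Mn1LA leaves room for at most one element
    of F below the first of them. *)
Lemma wt_below b s y : (forall z, colored kappa b z -> filter_part s z) ->
    minimal_in (colored kappa b) y ->
  finite_set (below b s y) /\ wt b s = -1 + #|` fset_set (below b s y)|%:Z.
Proof.
move=> allF ymin; have [yb miny] := ymin.
have nomax : ~ has_max b s by move=> [m [[/idealE nFm _] mb]]; case: nFm; exact: allF.
have Hm : has_min b s <-> below b s y = set0.
  split=> [[m [[Fm minm] mb]]|N0].
    have my : m = y.
      have /orP[my|ym] : (m >=< y)%O by apply: ECk; rewrite mb yb.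
        exact: miny.
      by apply/esym/minm => //; exact: allF.
    apply/seteqP; split=> // z [Fz zy _]; rewrite -my in zy.
    by move: (minm _ Fz (ltW zy)) => zm; rewrite zm ltxx in zy.
  exists y; split=> //; split=> [|z Fz]; first exact: allF.
  rewrite le_eqVlt => /orP[/eqP//|zy].
  have [w wy zw] := cover_below P_lf zy.
  suff : below b s y w by rewrite N0.
  split; [exact: filter_up zw|by case: wy|].
  by rewrite -yb; apply: NAk; left.
have [|N0|[x xE]] := @subset1P _ (below b s y).
- by move=> u v [_ yu ub] [_ yv vb]; exact: (Mnk ymin).
- rewrite N0 fset_set0 cardfs0; split=> //.
  by apply: (@wtE b s false true); split=> // _; apply/Hm.
- rewrite xE fset_set1 cardfs1; split=> //.
  apply: (@wtE b s false false); split=> //.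
  by move=> /Hm; rewrite xE => /seteqP[/(_ x erefl)].
Qed.

(** Local finiteness provides a last element of color b in I as soon as those
    elements are bounded above by some x; in the uses of this lemma, x is a minimal
    element of F. *)
Lemma last_exists b s x y : colored kappa b y -> ideal_part s y ->
    (forall z, colored kappa b z -> ideal_part s z -> (z <= x)%O) ->
  exists z, last_in_ideal b s z.
Proof.
move=> yb Iy lex.
pose A := [set z | [/\ colored kappa b z, ideal_part s z & (y <= z <= x)%O]].
have finA : finite_set A by apply: (@locally_finite_sub _ _ P_lf _ y x) => z [].
have [|m [[mb Im /andP[ym mx]] maxm] _] := finite_maximal (x := y) finA.
  by split=> //; rewrite lexx lex.
exists m; split=> // z [zb Iz] mz; apply: maxm => //; split=> //.
by rewrite lex// (le_trans ym mz).
Qed.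

Lemma first_exists b x y : colored kappa b y ->
    (forall z, colored kappa b z -> (x <= z)%O) ->
  exists z, minimal_in (colored kappa b) z.
Proof.
move=> yb lex.
pose A := [set z | colored kappa b z /\ (x <= z <= y)%O].
have finA : finite_set A by apply: (@locally_finite_sub _ _ P_lf _ x y) => z [].
have [|m [[mb /andP[xm my]] minm] _] := finite_minimal (x := y) finA.
  by split=> //; rewrite lexx lex.
exists m; split=> // z zb zm; apply: minm => //; split=> //.
by rewrite lex// (le_trans zm my).
Qed.

Lemma wt_no_last b s y : colored kappa b y -> ideal_part s y ->
  ~ (exists z, last_in_ideal b s z) -> wt b s = 0.
Proof.
move=> yb Iy nolast; apply: (@wtE b s false false); split=> //.
  move=> [m [[Im maxm] mb]]; case: nolast; exists m; split=> // z [_ Iz].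
  exact: maxm.
move=> [m [[Fm minm] mb]]; case: nolast; apply: (@last_exists b s m y) => //.
move=> z zb Iz; have /orP[//|mz] : (z >=< m)%O by apply: ECk; rewrite mb zb.
by move/idealE: (ideal_down Iz mz).
Qed.

Lemma wt_no_first b s : (forall z, colored kappa b z -> filter_part s z) ->
  ~ (exists z, minimal_in (colored kappa b) z) -> wt b s = 0.
Proof.
move=> allF nofirst; apply: (@wtE b s false false); split=> //.
  by move=> [m [[/idealE nFm _] mb]]; case: nFm; exact: allF.
move=> [m [[Fm minm] mb]]; case: nofirst; exists m; split=> // z zb.
exact/minm/allF.
Qed.

Lemma has_min_max_exclusive b s : has_min b s -> ~ has_max b s.
Proof.
move=> [y [[Fy miny] yb]] [x [[Ix maxx] xb]].
have xy : (x < y)%O.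
  have /orP[|yx] : (x >=< y)%O by apply: ECk; rewrite xb yb.
    by rewrite le_eqVlt => /orP[/eqP xy|//]; move/idealE: Ix; rewrite xy.
  by move/idealE: (ideal_down Ix yx).
suff /or_introl/NAk : covered_by x y by rewrite xb yb adj_irr.
split=> // -[z /andP[xz zy]]; have [Fz|/idealE Iz] := pselect (filter_part s z).
  by have zyE := miny z Fz (ltW zy); rewrite zyE ltxx in zy.
by have zx := maxx z Iz (ltW xz); rewrite zx ltxx in xz.
Qed.

(** The moved element x is comparable with all elements of color b, so it lies
    above those in I and below those in F.  Thus the set counted by [wt_above]
    gains x, or the set counted by [wt_below] loses it.  Surjectivity of the
    coloring ensures that one of the two cases occurs. *)
Lemma wt_adjacent_step a b s t : adj a b -> step a s t -> wt b t = wt b s - 1.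
Proof.
move=> ab [x sxt xa]; have [Fx st] := sxt.
have [_ minx] := adds_minimal sxt; have xb : adj (kappa x) b by rewrite xa.
have nxb z : colored kappa b z -> z <> x.
  by move=> zb zx; rewrite -zx zb adj_irr in xb.
have cmp z : colored kappa b z -> (x >=< z)%O by move=> zb; apply: ACk; rewrite zb.
have lastx z : colored kappa b z -> ideal_part s z -> (z < x)%O.
  move=> zb Iz; have /orP[xz|] := cmp z zb; first by move/idealE: (ideal_down Iz xz).
  by rewrite le_eqVlt => /orP[/eqP/(nxb _ zb)//|].
have firstx z : colored kappa b z -> filter_part s z -> (x < z)%O.
  move=> zb Fz; have /orP[|zx] := cmp z zb; last by case: (nxb z zb); exact: minx.
  by rewrite le_eqVlt => /orP[/eqP/esym/(nxb _ zb)//|].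
have It z : ideal_part t z <-> ideal_part s z \/ z = x.
  rewrite !idealE st; split=> [nF|[nF [] //|-> []//]].
  have [Fz|] := pselect (filter_part s z); last by left.
  by right; apply: contrapT => zx; apply: nF.
have [[y lasty]|nolast] := pselect (exists y, last_in_ideal b s y).
  have lasty' : last_in_ideal b t y.
    case: lasty => [[yb Iy] maxy]; split; first by split=> //; apply/It; left.
    by move=> z [zb /It[Iz|/(nxb _ zb)//]]; exact: maxy.
  have [finN ->] := wt_above lasty; have [_ ->] := wt_above lasty'.
  have -> : above b t y = x |` above b s y.
    apply/seteqP; split=> z.
      by case=> /It[Iz|->]; [right|left].
    case=> [->|[Iz yz zb]]; last by split=> //; apply/It; left.
    by case: lasty => [[yb Iy] _]; split=> //; [apply/It; right|exact: lastx].
  rewrite fset_setU1// cardfsU1 in_fset_set// memNset; last first.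
    by move=> [/idealE].
  by lia.
have [[y [yb Iy]]|allF] := pselect (exists y, colored kappa b y /\ ideal_part s y).
  case: nolast; apply: (last_exists yb Iy) => z zb Iz; exact/ltW/lastx.
have {}allF z : colored kappa b z -> filter_part s z.
  by move=> zb; apply: contrapT => /idealE Iz; apply: allF; exists z.
have allFt z : colored kappa b z -> filter_part t z.
  by move=> zb; apply/st; split; [exact: allF|exact: nxb].
have [y0 y0b] := kappa_surj b.
have [|y ymin] := @first_exists b x y0 y0b.
  by move=> z zb; apply/ltW/firstx => //; exact: allF.
have [finM ->] := wt_below allF ymin; have [finM' ->] := wt_below allFt ymin.
have -> : below b s y = x |` below b t y.
  apply/seteqP; split=> z.
    have [->|zx] := pselect (z = x); first by left.
    by case=> Fz zy zb; right; split=> //; apply/st.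
  case=> [->|[/st[Fz _] zy zb]]; last by split.
  by case: ymin => yb _; split=> //; apply: firstx => //; exact: allF.
rewrite fset_setU1// cardfsU1 in_fset_set// memNset; last by move=> [/st[]].
by lia.
Qed.

Lemma wt_distant_step a b s t : distant adj a b -> step a s t -> wt b t = wt b s.
Proof.
move=> /andP[/eqP ab /negP nab] [x sxt xa].
have xb y : kappa y = b -> y <> x by move=> yb yx; apply: ab; rewrite -xa -yx.
have ncov y : kappa y = b -> ~ covered_by x y /\ ~ covered_by y x.
  by move=> yb; split=> cov; apply: nab; rewrite -xa -yb; apply: NAk; [left|right].
rewrite /weight; congr (Posz (nat_of_bool _) - Posz (nat_of_bool _)).
  apply: asbool_equiv_eq; split=> -[y [my yb]]; exists y; split=> //.
    exact: adds_stays_maximal sxt my (xb _ yb).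
  by case: (adds_old_maximal sxt my) => // /(ncov _ yb).2.
apply: asbool_equiv_eq; split=> -[y [my yb]]; exists y; split=> //.
  by case: (adds_new_minimal sxt my) => // /(ncov _ yb).1.
exact: adds_stays_minimal sxt my (xb _ yb).
Qed.

Lemma jump_of_coloring : jump adj kappa wt.
Proof.
move=> a b s t sts; rewrite /theta; case: eqP => [<-|/eqP ab].
  have mins : has_min a s by apply/has_min_step; exists t.
  have maxt : has_max a t by apply/has_max_step; exists s.
  have -> : wt a t = 1.
    by apply: (@wtE a t true false); split=> // /has_min_max_exclusive.
  suff -> : wt a s = -1 by [].
  by apply: (@wtE a s false true); split=> // maxs; case: (has_min_max_exclusive mins).
case: ifP => [adjab|/negbT nadj]; first exact: wt_adjacent_step adjab sts.
by rewrite addr0; apply: wt_distant_step sts; rewrite /distant ab nadj.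
Qed.

Lemma mu_wt b s : mu adj kappa b s = wt b s.
Proof.
rewrite /mu; case: asboolP => [[y0 [y0b Iy0]]|noI].
  rewrite /upsilon; case: pselect => [ex|nolast]; last first.
    by rewrite (wt_no_last y0b Iy0).
  move: (projT1 (cid ex)) (projT2 (cid ex)) => y lasty /=.
  have [finN ->] := wt_above lasty.
  have fin c : adj c b -> finite_set (ideal_above kappa c s y).
    move=> cb; apply: sub_finite_set finN => z [zc Iz yz].
    by split=> //; rewrite zc.
  rewrite asboolF; last by move=> [c cb]; apply; exact: fin.
  congr (1 - Posz #|` fset_set _|); apply/seteqP; split=> z [] //.
  by move=> Iz yz zb; split=> //; exact: fin.
have allF z : colored kappa b z -> filter_part s z.
  by move=> zb; apply: contrapT => /idealE Iz; apply: noI; exists z.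
have PF : colored kappa b `&` filter_part s = colored kappa b.
  by apply/seteqP; split=> [z []//|z zb]; split=> //; exact: allF.
rewrite /psi; case: pselect => [ex|nofirst]; last first.
  by rewrite wt_no_first// -PF.
move: (projT1 (cid ex)) (projT2 (cid ex)) => y /=.
rewrite {1}PF => ymin; have [finM ->] := wt_below allF ymin.
have fin c : adj c b -> finite_set (filter_below kappa c s y).
  move=> cb; apply: sub_finite_set finM => z [zc Fz yz].
  by split=> //; rewrite zc.
rewrite asboolF; last by move=> [c cb]; apply; exact: fin.
congr (_ + Posz #|` fset_set _|); apply/seteqP; split=> z [] //.
by move=> Fz yz zb; split=> //; exact: fin.
Qed.

End ColoringToJump.

(** * Chains of moves *)

Section StepRelations.
Context {Gamma : finType} (adj : rel Gamma) {d : Order.disp_t}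
  {P : porderType d} (kappa : P -> Gamma).
Implicit Types (a b c : Gamma) (x y z : P) (r s t u : FIsplit P).

Local Notation wt := (weight kappa).
Local Notation step := (step kappa).

(** This will give [X_b, Y_a] = 0 for a different from b: an element can be put
    back into F before or after another one is moved to I, with the same result. *)
Lemma step_square a b s t : a <> b ->
  (exists r, step a r s /\ step b r t) <-> (exists u, step b s u /\ step a t u).
Proof.
move=> ab; split=> [[r [[y rys ya] [x rxt xb]]]|[u [[x sxu xb] [y tyu ya]]]].
  have xy : x <> y by move=> xy; apply: ab; rewrite -ya -xb xy.
  have minx := adds_stays_minimal rys (adds_minimal rxt) xy.
  have sxu := adds_to_ideal minx.
  exists (to_ideal s x); split; [by exists x|exists y => //].
  have [Ry rs] := rys; have [Rx rt] := rxt; have [Sx su] := sxu.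
  split; first by apply/rt; split=> //; exact: nesym.
  by move=> z; rewrite su rs rt; split=> [[[]]|[[]]].
have yx : y <> x by move=> xy; apply: ab; rewrite -ya -xb xy.
have maxy := adds_stays_maximal sxu (adds_maximal tyu) yx.
have rys := adds_to_filter maxy.
exists (to_filter s y); split; [by exists y|exists x => //].
have [Ry rs] := rys; have [Sx su] := sxu; have [Ty tu] := tyu.
split; first by have [] := (rs x).1 Sx.
move=> z; have [->|zy] := pselect (z = y); first by split.
have := su z; rewrite tu rs; tauto.
Qed.

Hypotheses (jw : jump adj kappa wt).

Let wt_bnd b u : -1 <= wt b u <= 1.
Proof. by case: (wt_range kappa b u) => ->. Qed.

Let ends a s t : step a s t -> wt a s = -1 /\ wt a t = 1.
Proof. exact: (jump_ends jw). Qed.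

Let ECk : EC kappa. Proof. exact: EC_of_jump jw wt_bnd. Qed.

Lemma no_step_twice a s t u : step a s t -> ~ step a t u.
Proof. by move=> /ends[_ at1] /ends[]; rewrite at1. Qed.

(** The weight of a is 1 after the first move and -1 before the last one, but the
    move in the middle cannot change it by -2.  For adjacent a and b this kills
    X_a X_b X_a. *)
Lemma no_step_aba a b s t u v : step a s t -> step b t u -> ~ step a u v.
Proof.
move=> /ends[_ at1] tbu /ends[au1 _]; move: (jw a tbu).
by rewrite at1 au1 /theta; case: ifP => // _; case: ifP.
Qed.

(** The weight of b is -1 before the second move, hence also before the first
    one, since theta_ab = 0. *)
Lemma distant_steps a b s t u : distant adj a b ->
  step a s t -> step b t u -> exists t', step b s t' /\ step a t' u.
Proof.
move=> /andP[/eqP ab /negbTE nab] sat tbu.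
have := jw b sat; rewrite /theta (introF eqP ab) nab addr0.
have [-> _] := ends tbu => /esym/wt_has_min[[y [miny yb]] _].
have [x sxt xa] := sat.
have yx : y <> x by move=> yx; apply: ab; rewrite -xa -yx.
have [y' tyu yb'] := tbu.
have yE : y = y'.
  apply: (min_unique ECk (adds_stays_minimal sxt miny yx) (adds_minimal tyu)).
  by rewrite yb yb'.
rewrite -yE in tyu; have syt' := adds_to_ideal miny.
exists (to_ideal s y); split; [by exists y|exists x => //].
have [_ st] := sxt; have [_ tu] := tyu; have [Fy st'] := syt'; have [Fx _] := sxt.
split; first by apply/st'; split=> //; exact: nesym.
by move=> z; rewrite tu st st'; split=> [[[]]|[[]]].
Qed.

End StepRelations.

(** * Linear maps on a free module *)

Section LinearMaps.
Variables (K : comNzRingType) (B : choiceType).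
Local Notation V := {malg K[B]}.

Lemma linear_span (W : lmodType K) (f : V -> W) (v : V) : linear f ->
  f v = \sum_(k <- msupp v) v@_k *: f << k >>.
Proof.
move=> flin.
have f0 : f 0 = 0 by have := flin (-1) 0 0; rewrite scaler0 addr0 scaleN1r addNr.
have fD u w : f (u + w) = f u + f w by have := flin 1 u w; rewrite !scale1r.
rewrite {1}[v]monalgE (big_morph f fD f0); apply: eq_bigr => k _.
have -> : << v@_k *g k >> = v@_k *: << k >> :> V.
  by apply/malgP => t; rewrite mcoeffZ !mcoeffU mulrnAr mulr1.
by have := flin v@_k << k >> 0; rewrite f0 !addr0.
Qed.

Lemma linear_eq (W : lmodType K) (f g : V -> W) : linear f -> linear g ->
  (forall k, f << k >> = g << k >>) -> f = g.
Proof.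
move=> flin glin fg; apply/funext => v; rewrite (linear_span v flin) (linear_span v glin).
by apply: eq_bigr => k _; rewrite fg.
Qed.

Lemma scale_basis_coeff (c : K) (k l : B) : (c *: << k >> : V)@_l = c *+ (k == l).
Proof. by rewrite mcoeffZ mcoeffU mulrnAr mulr1. Qed.

Lemma scale_basis_inj (c c' : K) (k : B) : c *: << k >> = c' *: << k >> :> V -> c = c'.
Proof. by move=> /malgP/(_ k); rewrite !scale_basis_coeff eqxx. Qed.

Lemma basis_inj (k l : B) : << k >> = << l >> :> V -> k = l.
Proof.
move=> /malgP/(_ k); rewrite !mcoeffU eqxx; case: eqP => [->//|_ /eqP].
by rewrite (negbTE (oner_neq0 _)).
Qed.

Lemma intr_scale1 (v : V) : v = 1%:~R *: v.
Proof. by rewrite scale1r. Qed.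

Lemma intr_scale0 (v : V) : 0 = 0%:~R *: v.
Proof. by rewrite scale0r. Qed.

Lemma diagonal_coeff (T : {linear V -> V}) (e : B -> K) (v : V) (l : B) :
  (forall k, T << k >> = e k *: << k >>) -> (T v)@_l = e l * v@_l.
Proof.
move=> Te; have id_lin : linear (@id V) by [].
have vE : v = \sum_(k <- msupp v) v@_k *: << k >> := linear_span v id_lin.
rewrite (linear_span v (linearP T)) [in RHS]vE !raddf_sum mulr_sumr.
apply: eq_bigr => k _ /=; rewrite Te mcoeffZ !scale_basis_coeff.
by case: eqP => [->|_]; rewrite ?mulr0 // !mulr1n mulrC.
Qed.

Lemma sum_basis_coeff (I : choiceType) (A : {fset I}) (g : I -> B) (l : B) :
  (\sum_(z <- A) << g z >> : V)@_l = (\sum_(z <- A) (g z == l))%:R.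
Proof. by rewrite raddf_sum natr_sum; apply: eq_bigr => z _; exact: mcoeffU. Qed.

(** A relation rather than a function on basis elements, so that the converse of
    a move is described as easily as the move.  A realized relation is functional,
    since distinct basis vectors differ. *)
Definition realizes (T : V -> V) (rho : B -> B -> Prop) := forall s,
  (forall t, rho s t -> T << s >> = << t >>) /\ ((forall t, ~ rho s t) -> T << s >> = 0).

Lemma realizesP T rho s : realizes T rho ->
  (exists2 t, rho s t & T << s >> = << t >>) \/ ((forall t, ~ rho s t) /\ T << s >> = 0).
Proof.
move=> /(_ s)[rT r0]; have [[t st]|nex] := pselect (exists t, rho s t).
  by left; exists t => //; exact: rT.
have nr t : ~ rho s t by move=> st; apply: nex; exists t.
by right; split=> //; exact: r0.
Qed.

Lemma realizes_comp (S T : {linear V -> V}) rho sigma :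
    realizes T rho -> realizes S sigma ->
  realizes (S \o T) (fun s u => exists t, rho s t /\ sigma t u).
Proof.
move=> rT rS s; case: (realizesP s rT) => [[t st Tt]|[nst T0]]; last first.
  by split=> [u [t [/nst]]//|_]; rewrite /= T0 linear0.
have tE t' : rho s t' -> t' = t.
  by move=> /(rT s).1; rewrite Tt => /basis_inj.
split=> /= [u [t' [/tE-> tu]]|nu]; rewrite Tt; first exact: (rS t).1.
by apply: (rS t).2 => u tu; apply: (nu u); exists t.
Qed.

Lemma realizes_eq S T rho sigma s : realizes S rho -> realizes T sigma ->
  (forall u, rho s u <-> sigma s u) -> S << s >> = T << s >>.
Proof.
move=> rS rT rs; case: (realizesP s rS) => [[t /rs st ->]|[nst ->]].
  by rewrite ((rT s).1 _ st).
by rewrite (rT s).2// => t /rs/nst.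
Qed.

Lemma realizes_converse (S T : {linear V -> V}) rho s (b : bool) :
    realizes S rho -> realizes T (fun t u => rho u t) ->
    (b <-> exists t, rho s t) ->
  T (S << s >>) = if b then << s >> else 0.
Proof.
move=> rS rT bE; case: (realizesP s rS) => [[t st ->]|[nst ->]].
  by rewrite ((rT t).1 _ st) (bE.2 (ex_intro _ t st)).
by rewrite linear0; case: b bE => // -[/(_ isT)[t /nst]].
Qed.

Lemma subr_if_scale (M m : bool) (v : V) :
  (if M then v else 0) - (if m then v else 0) = (M%:Z - m%:Z)%:~R *: v.
Proof.
by case: M; case: m; rewrite ?subrr ?subr0 ?sub0r ?scale0r ?scale1r ?scaleN1r.
Qed.

End LinearMaps.

(** * The operators X and Y *)

Section Operators.
Variable R : realType.
Context {Gamma : finType} (adj : rel Gamma) {d : Order.disp_t}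
  {P : porderType d} (kappa : P -> Gamma).
Local Notation C := R[i].
Local Notation V := {malg C[FIsplit P]}.
Local Notation ops := (Gamma -> {linear V -> V}).
Local Notation bv := (@basis_vec R d P).
Local Notation X := (@X_op R Gamma d P kappa).
Local Notation Y := (@Y_op R Gamma d P kappa).
Implicit Types (a b : Gamma) (s t u : FIsplit P) (H : ops) (f g : V -> V).

Lemma intr_scaleN1 s : - bv s = (-1)%:~R *: bv s.
Proof. by rewrite mulrN1z scaleN1r. Qed.

Lemma intr_scale_inj (m n : int) s : m%:~R *: bv s = n%:~R *: bv s -> m = n.
Proof. by move=> /scale_basis_inj/intr_inj. Qed.

Local Notation wt := (weight kappa).
Local Notation step := (step kappa).

Lemma mulrz_fctE f (n : int) v : (f *~ n) v = f v *~ n.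
Proof.
case: n => n; first by rewrite -!pmulrn natmulfctE.
by rewrite !NegzE !mulrNz -!pmulrn opprfctE natmulfctE.
Qed.

Lemma bracket_linear f g : linear f -> linear g -> linear (bracket f g).
Proof.
move=> lf lg c u v; rewrite /bracket !fctE /= lg lf lf lg.
by rewrite scalerBr opprD; rewrite addrACA.
Qed.

Lemma zero_linear : linear (0 : V -> V).
Proof. by move=> c u v; rewrite scaler0 addr0. Qed.

Lemma mulrz_linear f n : linear f -> linear (f *~ n).
Proof. by move=> lf c u v; rewrite !mulrz_fctE lf mulrzDl scalerMzr. Qed.

Lemma X_realizes a : EC kappa -> realizes (X a) (step a).
Proof.
move=> ECk s; rewrite /X_op /= lin_extU; split=> [t [x sxt xa]|nost].
  have -> : min_of_color kappa a s = [set x].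
    apply/seteqP; split=> [y [miny ya]|y ->]; last by split=> //; exact: adds_minimal sxt.
    by apply: min_unique ECk miny (adds_minimal sxt) _; rewrite xa ya.
  rewrite fsbig_set1; congr basis_vec.
  exact: adds_fun (adds_to_ideal (adds_minimal sxt)) sxt.
have -> : min_of_color kappa a s = set0; last by rewrite fsbig_set0.
by apply/seteqP; split=> // x [minx xa]; apply: nost (step_of_min minx xa).
Qed.

Lemma Y_realizes a : EC kappa -> realizes (Y a) (fun s t => step a t s).
Proof.
move=> ECk s; rewrite /Y_op /= lin_extU; split=> [t [x txs xa]|nost].
  have -> : max_of_color kappa a s = [set x].
    apply/seteqP; split=> [y [maxy ya]|y ->]; last by split=> //; exact: adds_maximal txs.
    by apply: max_unique ECk maxy (adds_maximal txs) _; rewrite xa ya.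
  rewrite fsbig_set1; congr basis_vec.
  exact: adds_inj (adds_to_filter (adds_maximal txs)) txs.
have -> : max_of_color kappa a s = set0; last by rewrite fsbig_set0.
apply/seteqP; split=> // x [maxx xa]; apply: (nost (to_filter s x)).
by exists x => //; exact: adds_to_filter.
Qed.

Lemma bracketE f g v : bracket f g v = f (g v) - g (f v).
Proof. by []. Qed.

Lemma commute_of_realizes (S T : {linear V -> V}) rho sigma :
    realizes S rho -> realizes T sigma ->
    (forall s u, (exists t, rho s t /\ sigma t u) <-> (exists t, sigma s t /\ rho t u)) ->
  bracket T S = 0.
Proof.
move=> rS rT com; apply: linear_eq => [||s].
- by apply: bracket_linear; exact: linearP.
- exact: zero_linear.
rewrite bracketE -[<< s >>]/(bv s).
have E : T (S (bv s)) = S (T (bv s)).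
  exact: realizes_eq (realizes_comp rS rT) (realizes_comp rT rS) (com s).
by rewrite E subrr.
Qed.

(** All four terms of [T_a, [T_a, T_b]] contain T_a T_a or T_a T_b T_a, so they
    vanish separately. *)
Lemma serre_of_realizes (T : ops) (rho : Gamma -> FIsplit P -> FIsplit P -> Prop) :
    (forall a, realizes (T a) (rho a)) ->
    (forall a s t u, rho a s t -> ~ rho a t u) ->
    (forall a b s t u v, rho a s t -> rho b t u -> ~ rho a u v) ->
    (forall a b s t u, distant adj a b -> rho a s t -> rho b t u ->
       exists t', rho b s t' /\ rho a t' u) ->
    symmetric adj ->
  serre adj T /\ square_nilpotent T.
Proof.
move=> rT aa aba ab adj_sym.
have sq a s : T a (T a (bv s)) = 0.
  have := realizes_comp (rT a) (rT a) s => -[_]; apply => u [t [st tu]].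
  exact: aa st tu.
have cube a b s : T a (T b (T a (bv s))) = 0.
  have := realizes_comp (realizes_comp (rT a) (rT b)) (rT a) s => -[_]; apply.
  by move=> v [u [[t [st tu]] uv]]; exact: aba st tu uv.
have sq0 a : (T a : V -> V) \o T a = 0.
  apply: linear_eq => [c u v||s]; [by rewrite /= !linearP|exact: zero_linear|].
  exact: sq.
split=> //.
split=> a b.
  move=> dab; apply: commute_of_realizes (rT a) (rT b) _ => s u.
  have dba : distant adj b a by move: dab; rewrite /distant eq_sym adj_sym.
  by split=> -[t [st tu]]; [exact: ab dab st tu|exact: ab dba st tu].
apply: linear_eq => [||s].
- by do 2?[apply: bracket_linear]; exact: linearP.
- exact: zero_linear.
have sqv v : T a (T a v) = 0 by exact: (congr1 (fun f : V -> V => f v) (sq0 a)).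
by rewrite -[<< s >>]/(bv s) !bracketE linearB /= sqv cube sqv !(linear0, addr0).
Qed.


Lemma bracket_XY_neq a b : EC kappa -> a <> b -> bracket (X b) (Y a) = 0.
Proof.
move=> ECk ab; apply: commute_of_realizes (Y_realizes a ECk) (X_realizes b ECk) _ => s t.
exact: step_square.
Qed.

Definition weight_op H := forall b s, H b (bv s) = (wt b s)%:~R *: bv s.

Lemma bracket_XY_wt a s : EC kappa ->
  bracket (X a) (Y a) (bv s) = (wt a s)%:~R *: bv s.
Proof.
move=> ECk; have rX := X_realizes a ECk; have rY := Y_realizes a ECk.
rewrite bracketE -subr_if_scale; congr (_ - _).
- apply: realizes_converse rY rX _; split=> [/asboolP/has_max_step//|maxs].
  exact/asboolP/has_max_step.
- apply: realizes_converse rX rY _; split=> [/asboolP/has_min_step//|mins].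
  exact/asboolP/has_min_step.
Qed.

Lemma X_basis a s : finite_set (min_of_color kappa a s) ->
  X a (bv s) = \sum_(x <- fset_set (min_of_color kappa a s)) << to_ideal s x >>.
Proof. by move=> fin; rewrite /X_op /= lin_extU fsbig_finite. Qed.

Lemma X_coeff a s t : finite_set (min_of_color kappa a s) ->
  (X a (bv s))@_t = (`[< step a s t >] : nat)%:R.
Proof.
move=> fin; rewrite X_basis// sum_basis_coeff; congr (_%:R).
case: asboolP => [[x sxt xa]|nst].
  have minx := adds_minimal sxt.
  have tE := adds_fun (adds_to_ideal minx) sxt.
  have xin : x \in fset_set (min_of_color kappa a s) by rewrite in_fset_set// inE.
  rewrite (big_fsetD1 x xin) /= tE eqxx big1_fset// => y.
  rewrite in_fsetD1 => /andP[/eqP yx]; rewrite in_fset_set// inE => -[miny _] _.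
  case: eqP => // yt; case: yx.
  by have := adds_to_ideal miny; rewrite yt => /adds_elt; apply.
rewrite big1_fset// => y; rewrite in_fset_set// inE => -[miny ya] _.
by case: eqP => // yt; case: nst; rewrite -yt; exact: step_of_min.
Qed.

(** Compare the coefficients of t in HX applied to s: that of X_a s is 1,
    so what remains is an identity of integers, read in the complex numbers. *)
Lemma jump_of_HX H (f : Gamma -> FIsplit P -> int) :
    X_defined kappa -> (forall b s, H b (bv s) = (f b s)%:~R *: bv s) ->
    rel_HX adj H X -> jump adj kappa f.
Proof.
move=> Xdef Hf HX a b s t st.
have Hcoeff v : (H b v)@_t = (f b t)%:~R * v@_t.
  exact: (diagonal_coeff (e := fun s => (f b s)%:~R) v t (Hf b)).
have := congr1 (fun g : V -> V => (g (bv s))@_t) (HX a b).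
rewrite /= mulrz_fctE bracketE mcoeffB Hcoeff Hf linearZ mcoeffZ.
rewrite [in RHS]raddfMz /= X_coeff// asboolT// !mulr1 -rmorphB /=.
by move=> /intr_inj <-; rewrite addrC subrK.
Qed.

(** If x and y are both minimal in F with color a, then (F - x - y, I + x + y)
    occurs in X_a^2 (F, I), and no other term can cancel it. *)
Lemma EC_of_nilpotent : X_defined kappa -> square_nilpotent X -> EC kappa.
Proof.
move=> Xdef XX; apply: EC_of_unique_min => a s x y [minx xa] [miny ya].
apply: contrapT => xy; pose t := to_ideal s x.
have sxt := adds_to_ideal minx.
have minyt := adds_stays_minimal sxt miny (nesym xy).
have tu := step_of_min minyt ya.
pose A := fset_set (min_of_color kappa a s).
have := congr1 (fun g : V -> V => (g (bv s))@_(to_ideal t y)) (XX a).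
have xA : x \in A by rewrite in_fset_set// inE.
rewrite /= X_basis// linear_sum raddf_sum /=.
under eq_bigr do rewrite X_coeff//.
rewrite -natr_sum mcoeff0 => /eqP.
by rewrite pnatr_eq0 (big_fsetD1 x xA) /= asboolT.
Qed.

(** * Representations force the weights *)

Lemma prescribed_rep_weight H : prescribed_rep R adj kappa H ->
  jump adj kappa wt /\ weight_op H.
Proof.
move=> [[Xdef _ _ _ HX] _ pres]; have wH : weight_op H; last first.
  by split=> //; exact: jump_of_HX Xdef wH HX.
move=> b s; have [Hmin Hmax H0] := pres b s.
rewrite /weight; case: asboolP => [maxs|nmax]; case: asboolP => [mins|nmin].
- have := Hmin mins; rewrite (Hmax maxs) [LHS](intr_scale1 (bv s)) [RHS](intr_scaleN1 s).
  by move=> /intr_scale_inj.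
- by rewrite (Hmax maxs) -(intr_scale1 (bv s)).
- by rewrite (Hmin mins) -(intr_scaleN1 s).
- by rewrite H0// -(intr_scale0 (bv s)).
Qed.

Lemma upper_lower_rep_weight H : upper_lower_rep R adj kappa H ->
  jump adj kappa wt /\ weight_op H.
Proof.
move=> [[[Xdef Hdiag _ _ HX] _ evge Hmin] [_ _ evle Hmax]].
have wH : weight_op H; last by split=> //; exact: jump_of_HX Xdef wH HX.
move=> b s; have [c Hc] := Hdiag b s.
have [|n /= n_ge nc] := evge c; first by exists b, s.
have [|m /= m_le mc] := evle c; first by exists b, s.
have mn : m = n by apply: (@intr_inj C); rewrite mc nc.
have minE : has_min kappa b s <-> n = -1.
  split=> [mins|nE]; last first.
    by apply: (Hmin s b).1; rewrite Hc -nc nE (intr_scaleN1 s); reflexivity.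
  by have := (Hmin s b).2 mins; rewrite Hc -nc (intr_scaleN1 s) => /intr_scale_inj.
have maxE : has_max kappa b s <-> n = 1.
  split=> [maxs|nE]; last by apply: (Hmax s b).1; rewrite Hc -nc nE -(intr_scale1 (bv s)).
  have := (Hmax s b).2 maxs; rewrite Hc -nc.
  by rewrite [RHS](intr_scale1 (bv s)) => /intr_scale_inj.
suff -> : wt b s = n by rewrite Hc -nc; reflexivity.
by rewrite /weight; case: asboolP => /maxE; case: asboolP => /minE; lia.
Qed.

Lemma nilpotent_rep_weight H : nilpotent_rep R adj kappa H ->
  jump adj kappa wt /\ weight_op H.
Proof.
move=> [[[Xdef _ _ _ HX] _] XX _ XYH].
have ECk := EC_of_nilpotent Xdef XX.
have wH : weight_op H by move=> b s; rewrite -XYH bracket_XY_wt.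
by split=> //; exact: jump_of_HX Xdef wH HX.
Qed.

(** The eigenvalues are first known as some integer valued f only; its jumps give
    EC, and then the relation [X_a, Y_a] = H_a identifies f with the weight. *)
Lemma g_minuscule_weight H : g_minuscule R adj kappa H ->
  jump adj kappa wt /\ weight_op H.
Proof.
move=> [[[Xdef _] Hdiag _ [_ HX _] [XYH _]] ev].
have [f fH] : exists f : Gamma -> FIsplit P -> int,
    forall b s, H b (bv s) = (f b s)%:~R *: bv s /\ -1 <= f b s <= 1.
  suff ex b s : exists n : int, H b (bv s) = n%:~R *: bv s /\ -1 <= n <= 1.
    by exists (fun b s => projT1 (cid (ex b s))) => b s; exact: projT2 (cid (ex b s)).
  have [c Hc] := Hdiag b s.
  have [|[cE|cE]|cE] := ev c; first by exists b, s.
  - exists (-1); split; last by [].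
    by rewrite Hc cE mulrN1z; reflexivity.
  - exists 0; split; last by [].
    by rewrite Hc cE; reflexivity.
  - exists 1; split; last by [].
    by rewrite Hc cE; reflexivity.
have jf : jump adj kappa f by apply: jump_of_HX Xdef _ HX => b s; have [] := fH b s.
have ECk : EC kappa by apply: EC_of_jump jf _ => b s; have [] := fH b s.
have wH : weight_op H by move=> b s; rewrite -XYH bracket_XY_wt.
by split=> //; exact: jump_of_HX Xdef wH HX.
Qed.

(** * Weights provide representations *)

Lemma bracket_weight_step (T : {linear V -> V}) rho H b (n : int) :
    weight_op H -> realizes T rho ->
    (forall s t, rho s t -> wt b t = wt b s + n) ->
  bracket (H b) T = (T : V -> V) *~ n.
Proof.
move=> wH rT jrho; apply: linear_eq => [||s].
- by apply: bracket_linear; exact: linearP.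
- by apply: mulrz_linear; exact: linearP.
rewrite mulrz_fctE bracketE -[<< s >>]/(bv s) wH linearZ /=.
case: (realizesP s rT) => [[t st Tt]|[nst T0]].
  rewrite -[<< t >>]/(bv t) in Tt.
  by rewrite Tt wH -scalerBl (jrho _ _ st) -rmorphB addrC addKr scaler_int.
by rewrite T0 scaler0 linear0 subr0 mul0rz.
Qed.

Lemma rel_HH_weight H : weight_op H -> rel_HH H.
Proof.
move=> wH a b; apply: linear_eq => [||s].
- by apply: bracket_linear; exact: linearP.
- exact: zero_linear.
have HH x y : H x (H y (bv s)) = ((wt y s)%:~R * (wt x s)%:~R) *: bv s.
  by rewrite wH linearZ /= wH scalerA.
by rewrite bracketE -[<< s >>]/(bv s) !HH mulrC subrr.
Qed.

Section WeightRepresentations.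
Hypotheses (adj_sym : symmetric adj) (jw : jump adj kappa wt).
Variables (H : ops) (wH : weight_op H).

Let wt_bnd b u : -1 <= wt b u <= 1.
Proof. by case: (wt_range kappa b u) => ->. Qed.

Let ECk : EC kappa. Proof. exact: EC_of_jump jw wt_bnd. Qed.

Let X_def : X_defined kappa.
Proof.
move=> a s; have [|->|[x ->]] := @subset1P _ (min_of_color kappa a s); last 2 first.
- exact: finite_set0.
- exact: finite_set1.
by move=> x y [mx xa] [my ya]; apply: min_unique ECk mx my _; rewrite xa ya.
Qed.

Let Y_def : Y_defined kappa.
Proof.
move=> a s; have [|->|[x ->]] := @subset1P _ (max_of_color kappa a s); last 2 first.
- exact: finite_set0.
- exact: finite_set1.
by move=> x y [mx xa] [my ya]; apply: max_unique ECk mx my _; rewrite xa ya.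
Qed.

Let diagH a : Defs.diagonal (H a).
Proof. by move=> s; exists (wt a s)%:~R; exact: wH. Qed.

Lemma X_serre : serre adj X /\ square_nilpotent X.
Proof.
apply: (@serre_of_realizes X (step)) => //.
- by move=> a; exact: X_realizes.
- by move=> a s t u; exact: (no_step_twice jw).
- by move=> a b s t u v; exact: (no_step_aba jw).
- by move=> a b s t u; exact: (distant_steps jw).
Qed.

Lemma Y_serre : serre adj Y /\ square_nilpotent Y.
Proof.
apply: (@serre_of_realizes Y (fun a s t => step a t s)) => //.
- by move=> a; exact: Y_realizes.
- by move=> a s t u ts ut; exact: (no_step_twice jw ut ts).
- by move=> a b s t u v ts ut vu; exact: (no_step_aba jw vu ut ts).
- move=> a b s t u dab ts ut; have dba : distant adj b a.
    by move: dab; rewrite /distant eq_sym adj_sym.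
  by have [t' [ut' t's]] := distant_steps jw dba ut ts; exists t'.
Qed.

Lemma weight_rep_bplus : rep_bplus adj kappa H.
Proof.
split=> //; [exact: X_serre.1|exact: rel_HH_weight|].
move=> a b; apply: bracket_weight_step wH (X_realizes a ECk) _ => s t.
exact: jw.
Qed.

Lemma weight_rep_bminus : rep_bminus adj kappa H.
Proof.
split=> //; [exact: Y_serre.1|exact: rel_HH_weight|].
move=> a b; apply: bracket_weight_step wH (Y_realizes a ECk) _ => s t /(jw b) ->.
by rewrite addrK.
Qed.

Lemma weight_bracket a : bracket (X a) (Y a) = H a.
Proof.
apply: linear_eq => [||s].
- by apply: bracket_linear; exact: linearP.
- exact: linearP.
- by rewrite -[<< s >>]/(bv s) wH; exact: bracket_XY_wt.
Qed.

Lemma weight_prescribed : prescribed_rep R adj kappa H.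
Proof.
split; [exact: weight_rep_bplus|exact: weight_rep_bminus|move=> b s; split].
- by move=> mins; rewrite wH (wt_min jw mins) intr_scaleN1.
- by move=> maxs; rewrite wH (wt_max jw maxs) -intr_scale1.
- move=> nmin nmax; rewrite wH /weight !asboolF// -intr_scale0//.
Qed.

Lemma weight_nilpotent : nilpotent_rep R adj kappa H.
Proof.
split; [split|exact: X_serre.2|exact: Y_serre.2|exact: weight_bracket].
  exact: weight_rep_bplus.
exact: weight_rep_bminus.
Qed.

Lemma weight_eigenvalue c : eigenvalue_set H c ->
  exists2 n : int, [\/ n = -1, n = 0 | n = 1] & c = n%:~R.
Proof.
move=> [a [s]]; rewrite wH => /scale_basis_inj <-.
by exists (wt a s) => //; exact: wt_range.
Qed.

Lemma weight_g_minuscule : g_minuscule R adj kappa H.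
Proof.
have [Xd HD sX HH HX] := weight_rep_bplus; have [Yd _ sY _ HY] := weight_rep_bminus.
split.
  split; [by []|by []|by []|by []|split; first exact: weight_bracket].
  by move=> a b /eqP ab; exact: bracket_XY_neq.
move=> c /weight_eigenvalue[n [->|->|->] ->].
- by left; left; rewrite mulrN1z.
- by left; right.
- by right.
Qed.

Lemma weight_upper_lower : upper_lower_rep R adj kappa H.
Proof.
have scale_wt (n : int) s a : H a (bv s) = n%:~R *: bv s <-> wt a s = n.
  by rewrite wH; split=> [/intr_scale_inj//|->].
split; split.
- exact: weight_rep_bplus.
- exact: X_serre.2.
- by move=> c /weight_eigenvalue[n n3 ->]; exists n => //=; case: n3 => ->.
- move=> s a; rewrite intr_scaleN1 scale_wt; split=> [/wt_has_min[]//|].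
  exact: (wt_min jw).
- exact: weight_rep_bminus.
- exact: Y_serre.2.
- by move=> c /weight_eigenvalue[n n3 ->]; exists n => //=; case: n3 => ->.
- move=> s a; rewrite [X in _ = X](intr_scale1 (bv s)) scale_wt.
  split=> [/wt_has_max[]//|]; exact: (wt_max jw).
Qed.

End WeightRepresentations.

Lemma weight_unique H H' : weight_op H -> weight_op H' -> forall a, H' a =1 H a.
Proof.
move=> wH wH' a v; have -> // : H' a = H a :> (V -> V).
apply: linear_eq => [||s]; [exact: linearP|exact: linearP|].
by rewrite -[<< s >>]/(bv s) wH wH'.
Qed.

Lemma M_op_weight : (forall b s, mu adj kappa b s = wt b s) ->
  weight_op (M_op R adj kappa).
Proof. by move=> muE b s; rewrite /M_op /= lin_extU muE. Qed.

End Operators.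

(** * The equivalence *)

Theorem theorem11p2 (R : realType)
    (Gamma : finType) (adj : rel Gamma)
    (adj_sym : symmetric adj) (adj_irr : irreflexive adj)
    (d : Order.disp_t) (P : porderType d) (P_lf : locally_finite P)
    (kappa : P -> Gamma) (kappa_surj : forall a, exists x, kappa x = a) :
  [<-> exists H, upper_lower_rep R adj kappa H;
       exists H, prescribed_rep R adj kappa H;
       coloring_properties adj kappa;
       exists H, nilpotent_rep R adj kappa H;
       exists H, g_minuscule R adj kappa H] /\
  ((exists H, upper_lower_rep R adj kappa H) \/
   (exists H, prescribed_rep R adj kappa H) \/
   coloring_properties adj kappa \/
   (exists H, nilpotent_rep R adj kappa H) \/
   (exists H, g_minuscule R adj kappa H) ->
   [/\ unique_ops (upper_lower_rep R adj kappa) (M_op R adj kappa),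
       unique_ops (prescribed_rep R adj kappa) (M_op R adj kappa),
       unique_ops (nilpotent_rep R adj kappa) (M_op R adj kappa)
     & unique_ops (g_minuscule R adj kappa) (M_op R adj kappa)]).
Proof.
have jumpP : coloring_properties adj kappa -> jump adj kappa (weight kappa).
  by move=> [? ? ? [? ? ?]]; exact: jump_of_coloring.
split.
  tfae.
  - move=> [H /upper_lower_rep_weight[jw wH]]; exists H.
    exact: weight_prescribed.
  - move=> [H /prescribed_rep_weight[jw _]]; exact: coloring_of_jump jw.
  - move=> col; have jw := jumpP col; exists (M_op R adj kappa).
    apply: weight_nilpotent => //; apply: M_op_weight.
    by case: col => [? ? ? [? ? ?]]; exact: mu_wt.
  - move=> [H /nilpotent_rep_weight[jw wH]]; exists H.
    exact: weight_g_minuscule.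
  - move=> [H /g_minuscule_weight[jw wH]]; exists H.
    exact: weight_upper_lower.
move=> anyone; have jw : jump adj kappa (weight kappa).
  case: anyone => [[H /upper_lower_rep_weight[]//]|].
  case=> [[H /prescribed_rep_weight[]//]|].
  case=> [/jumpP//|].
  by case=> [[H /nilpotent_rep_weight[]]|[H /g_minuscule_weight[]]].
have wM : weight_op kappa (M_op R adj kappa).
  apply: M_op_weight; have [? ? ? [? ? ?]] := coloring_of_jump adj_irr adj_sym P_lf jw.
  exact: mu_wt.
split; split.
- exact: weight_upper_lower.
- by move=> H /upper_lower_rep_weight[_]; exact: weight_unique.
- exact: weight_prescribed.
- by move=> H /prescribed_rep_weight[_]; exact: weight_unique.
- exact: weight_nilpotent.
- by move=> H /nilpotent_rep_weight[_]; exact: weight_unique.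
- exact: weight_g_minuscule.
- by move=> H /g_minuscule_weight[_]; exact: weight_unique.
Qed.
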